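(* Let $\mu=(\mu_1,\dots,\mu_n)\in\mathbb Z^n$. (a) If $\mu_i>\mu_{i+1}>0$ or $0>\mu_i>\mu_{i+1}$ for some $i\in\{1,\dots,n-1\}$, then $$\widehat E_{s_i\mu}=\mathrm{ev}_\mu(C_{\alpha_i})\widehat E_\mu-(t^{-\frac12}x_{i+1}-t^{\frac12}x_i)\,\partial_i\widehat E_\mu .$$ (b) If $\mu_n>0$, then $$\widehat E_{s_n\mu}=\mathrm{ev}_\mu(C_{\alpha_n})\widehat E_\mu-t_n^{-\frac12}(1-t_n^{\frac12}u_n^{\frac12}x_n)(1+t_n^{\frac12}u_n^{-\frac12}x_n)\,\partial_n\widehat E_\mu .$$ (c) If $\mu_1\le0$, then $$\widehat E_{s_0\mu}=\mathrm{ev}_\mu(F^-_{\alpha_0})\widehat E_\mu+t_0^{-\frac12}\mathrm{ev}_\mu(Y_1)x_1\widehat E_\mu-\mathrm{ev}_\mu(Y_1)\big(t_0^{-\frac12}x_1^3+(u_0^{-\frac12}-u_0^{\frac12})q^{\frac12}x_1^2-t_0^{\frac12}q\,x_1\big)\partial_0\widehat E_\mu .$$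
   Context: **Parameters and operators.** Fix $n\ge1$. Let $q^{1/2},t^{1/2},t_0^{1/2},u_0^{1/2},t_n^{1/2},u_n^{1/2}$ be independent parameters, $\mathbb K$ the field of rational functions in them over $\mathbb C$, and $\mathbb K[x^{\pm1}]=\mathbb K[x_1^{\pm1},\dots,x_n^{\pm1}]$. On $\mathbb K[x^{\pm1}]$ let $(\xi_0f)(x)=f(qx_1^{-1},x_2,\dots,x_n)$, $\xi_i$ ($1\le i\le n-1$) exchange $x_i,x_{i+1}$, and $(\xi_nf)(x)=f(x_1,\dots,x_{n-1},x_n^{-1})$. Divided-difference operators: $\partial_0=\frac{1}{x_1^2-q}(1-\xi_0)$, $\partial_i=\frac1{x_{i+1}-x_i}(1-\xi_i)$ for $1\le i\le n-1$, $\partial_n=\frac1{1-x_n^2}(1-\xi_n)$. Define $$t_0^{1/2}T_0=t_0-(x_1+q^{1/2}t_0^{1/2}u_0^{-1/2})(x_1-q^{1/2}t_0^{1/2}u_0^{1/2})\partial_0,\quad t^{1/2}T_i=t-(x_{i+1}-tx_i)\partial_i\ (1\le i\le n-1),$$ $$t_n^{1/2}T_n=t_n-(1+t_n^{1/2}u_n^{-1/2}x_n)(1-t_n^{1/2}u_n^{1/2}x_n)\partial_n,$$ $(T_0^\vee)^{-1}=X_1T_1\cdots T_{n-1}T_nT_{n-1}\cdots T_1$ with $X_1$ multiplication by $x_1$, and $Y_j=T_{j-1}^{-1}\cdots T_1^{-1}T_0T_1\cdots T_{n-1}T_nT_{n-1}\cdots T_j$, $1\le j\le n$. **Actions.** $s_0,\dots,s_n$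 act on $\mathbb Z^n$ by $s_0\mu=(1-\mu_1,\mu_2,\dots,\mu_n)$, $s_i$ exchanges $\mu_i,\mu_{i+1}$ ($1\le i\le n-1$), $s_n\mu=(\mu_1,\dots,\mu_{n-1},-\mu_n)$. $W_{\mathrm{fin}}$ is the group of signed permutations of $\{\pm1,\dots,\pm n\}$ generated by $s_1,\dots,s_n$ ($s_i=(i\leftrightarrow i+1)$, $s_n=(n\leftrightarrow-n)$); in a reduced word for $w$, $\ell_d(w)$ is the number of $s_n$'s and $\ell_s(w)$ the number of other factors. **Evaluations.** $v_\mu\in W_{\mathrm{fin}}$ is the minimal length element such that $v_\mu\mu$ is weakly increasing with all entries $\le0$, and $\mathrm{ev}_\mu$ is the homomorphism $\mathbb K[Y_1^{\pm1},\dots,Y_n^{\pm1}]\to\mathbb K$, $\mathrm{ev}_\mu(Y_j)=q^{-\mu_j}t^{-v_\mu(j)}(t_0^{1/2}t_n^{1/2}t^n)^{\mathrm{sgn}(v_\mu(j))}$, extended to rational functions whose denominator does not evaluate to $0$. **$C$ and $F^\pm$.** $$C_{\alpha_i}=t^{-\frac12}\frac{1-tY_i^{-1}Y_{i+1}}{1-Y_i^{-1}Y_{i+1}}\ (1\le i\le n-1),\qquad C_{\alpha_n}=t_n^{-\frac12}\frac{(1-t_0^{\frac12}t_n^{\frac12}Y_n^{-1})(1+t_n^{\frac12}t_0^{-\frac12}Y_n^{-1})}{1-Y_n^{-2}},$$ $$F^-_{\alpha_0}=\frac{\big((u_n^{-\frac12}-u_n^{\frac12})+(u_0^{-\frac12}-u_0^{\frac12})q^{-\frac12}Y_1^{-1}\big)qY_1^2}{1-qY_1^2},\qquad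 F^+_{\alpha_i}=t^{-\frac12}\frac{1-t}{1-Y_i^{-1}Y_{i+1}}\ (1\le i\le n-1),$$ $$F^+_{\alpha_n}=\frac{(t_n^{-\frac12}-t_n^{\frac12})+(t_0^{-\frac12}-t_0^{\frac12})Y_n^{-1}}{1-Y_n^{-2}}.$$ **The polynomials $\widehat E_\mu$.** They are defined recursively by $\widehat E_{(0,\dots,0)}=1$; $\widehat E_{s_0\mu}=\tau_0\widehat E_\mu$ if $\mu_1\le0$; $\widehat E_{s_i\mu}=\tau_i\widehat E_\mu$ if $1\le i\le n-1$ and $\mu_i>\mu_{i+1}$; $\widehat E_{s_n\mu}=\tau_n\widehat E_\mu$ if $\mu_n>0$. Here $\tau_0=(T_0^\vee)^{-1}+F^-_{\alpha_0}$, $\tau_i=T_i+F^+_{\alpha_i}$ ($1\le i\le n$), and a rational function $f(Y)$ acts on $\widehat E_\mu$ as the scalar $\mathrm{ev}_\mu(f)$ (one has $Y_j\widehat E_\mu=\mathrm{ev}_\mu(Y_j)\widehat E_\mu$). Equivalently $\widehat E_\mu=t^{\frac12\ell_s(v_\mu^{-1})}t_n^{\frac12\ell_d(v_\mu^{-1})}E_\mu$, where $E_\mu$ is the electronic (nonsymmetric) Koornwinder polynomial, i.e. the simultaneous eigenvector $Y_jE_\mu=\mathrm{ev}_\mu(Y_j)E_\mu$ in which $x_1^{\mu_1}\cdots x_n^{\mu_n}$ has coefficient $1$. *)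

(* Defs.v *)
From HB Require Import structures.
From mathcomp Require Import all_boot all_order all_fingroup all_algebra.
From mathcomp Require Import reals complex mpoly.
From Stdlib Require Import ClassicalEpsilon.

Set Implicit Arguments.
Unset Strict Implicit.
Unset Printing Implicit Defensive.

Import Order.TTheory GRing.Theory Num.Theory.
Local Open Scope ring_scope.

(* The rank is n = m.+1 >= 1 and indices are 0-based: the mathematical index
   1 <= j <= n is the ordinal of value j - 1 in 'I_m.+1, and 1 <= i <= n - 1 is
   the ordinal of value i - 1 in 'I_m.  For i : 'I_m, [lo i] and [hi i] stand for
   i and i + 1 as positions. *)
Definition lo m (i : 'I_m) : 'I_m.+1 := widen_ord (leqnSn m) i.
Definition hi m (i : 'I_m) : 'I_m.+1 := lift ord0 i.

(** ** Actions of the simple reflections *)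

Section Weights.

Variable m : nat.

Definition weight := {ffun 'I_m.+1 -> int}.

Implicit Types (mu : weight) (i : 'I_m).

Definition weight0 : weight := [ffun=> 0].

Definition s_first mu : weight :=
  [ffun j => if j == ord0 then 1 - mu j else mu j].
Definition s_mid i mu : weight := [ffun j => mu (tperm (lo i) (hi i) j)].
Definition s_last mu : weight :=
  [ffun j => if j == ord_max then - mu j else mu j].

(* The set {+-1, ..., +-n}: (false, j) is j + 1 and (true, j) is - (j + 1). *)
Definition spt := (bool * 'I_m.+1)%type.

Definition spt_int (p : spt) : int :=
  if p.1 then - (p.2.+1)%:Z else (p.2.+1)%:Z.

(* [Some i] is the reflection s_i with 1 <= i <= n - 1, [None] is s_n. *)
Definition simple_refl (k : option 'I_m) : {perm spt} :=
  if k is Some i then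
    (tperm (false, lo i) (false, hi i) * tperm (true, lo i) (true, hi i))%g
  else tperm (false, ord_max) (true, ord_max).

Definition Wfin : {set {perm spt}} := <<[set simple_refl k | k : option 'I_m]>>%g.

Definition has_word (w : {perm spt}) (k : nat) : bool :=
  [exists s : k.-tuple (option 'I_m), w == (\prod_(a <- s) simple_refl a)%g].

(* Coxeter length; the lengths of the elements of Wfin are all < #|Wfin|. *)
Definition wlength (w : {perm spt}) : nat := find (has_word w) (iota 0 #|Wfin|).

(* (w mu)_{w(j)} = mu_j for j in {+-1, ..., +-n}, with mu_{-j} = - mu_j; the
   simple reflections act as s_mid and s_last. *)
Definition wact (w : {perm spt}) mu : weight :=
  [ffun j => let p := (w^-1)%g (false, j) in if p.1 then - mu p.2 else mu p.2].

Definition antidominant mu : bool :=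
  [forall j, mu j <= 0] && [forall i : 'I_m, mu (lo i) <= mu (hi i)].

Definition v_ mu : {perm spt} :=
  odflt 1%g [pick v in Wfin | antidominant (wact v mu) &&
    [forall w in Wfin, antidominant (wact w mu) ==> (wlength v <= wlength w)%N]].

End Weights.

(** ** Parameters: square roots of q, t, t_0, u_0, t_n, u_n *)

Record params (K : Type) := Params {
  qh : K; th : K; t0h : K; u0h : K; tnh : K; unh : K }.

Section Koornwinder.

Variables (K : fieldType) (pr : params K) (m : nat).

Local Notation qh := (qh pr).
Local Notation th := (th pr).
Local Notation t0h := (t0h pr).
Local Notation u0h := (u0h pr).
Local Notation tnh := (tnh pr).
Local Notation unh := (unh pr).
Local Notation q := (qh ^+ 2).
Local Notation t := (th ^+ 2).
Local Notation t0 := (t0h ^+ 2).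
Local Notation tn := (tnh ^+ 2).

(* Rational functions over K in n variables.  This serves both as K(x), the
   ambient field of K[x^{+-1}] in which the divided differences are genuine
   quotients (all the operators below preserve K[x^{+-1}]), and as K(Y). *)
Definition ratfun : fieldType := {fraction {mpoly K[m.+1]}}.

Definition cst (c : K) : ratfun := tofrac (c%:MP).
Definition var (j : 'I_m.+1) : ratfun := tofrac 'X_j.

(** ** Operators on K(x) *)

(* Substitution of y j for the j-th variable; it is used for invertible
   substitutions only, so no denominator is sent to 0. *)
Definition subst (y : 'I_m.+1 -> ratfun) (f : ratfun) : ratfun :=
  mmap cst y \n_(generic_quotient.repr f) / mmap cst y \d_(generic_quotient.repr f).

Local Notation x := var.
Local Notation x1 := (var ord0).
Local Notation xn := (var ord_max).

Definition xi_first : ratfun -> ratfun :=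
  subst (fun j => if j == ord0 then cst q / x1 else x j).
Definition xi_mid (i : 'I_m) : ratfun -> ratfun :=
  subst (fun j => x (tperm (lo i) (hi i) j)).
Definition xi_last : ratfun -> ratfun :=
  subst (fun j => if j == ord_max then xn^-1 else x j).

Definition partial_first (f : ratfun) : ratfun :=
  (x1 ^+ 2 - cst q)^-1 * (f - xi_first f).
Definition partial_mid (i : 'I_m) (f : ratfun) : ratfun :=
  (x (hi i) - x (lo i))^-1 * (f - xi_mid i f).
Definition partial_last (f : ratfun) : ratfun :=
  (1 - xn ^+ 2)^-1 * (f - xi_last f).

Definition T_mid (i : 'I_m) (f : ratfun) : ratfun :=
  cst th^-1 * (cst t * f - (x (hi i) - cst t * x (lo i)) * partial_mid i f).
Definition T_last (f : ratfun) : ratfun :=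
  cst tnh^-1 * (cst tn * f
    - (1 + cst (tnh / unh) * xn) * (1 - cst (tnh * unh) * xn) * partial_last f).

Definition T_mids : seq (ratfun -> ratfun) := [seq T_mid i | i <- enum 'I_m].

(* (T_0^vee)^{-1} = X_1 T_1 ... T_{n-1} T_n T_{n-1} ... T_1 *)
Definition T0vee_inv (f : ratfun) : ratfun :=
  x1 * foldr (fun T g => T g) f (T_mids ++ T_last :: rev T_mids).

(** ** Rational functions of Y and their evaluations *)

Local Notation Y := var.
Local Notation Y1 := (var ord0).
Local Notation Yn := (var ord_max).

Definition C_mid (i : 'I_m) : ratfun :=
  cst th^-1 * ((1 - cst t * (Y (lo i))^-1 * Y (hi i))
               / (1 - (Y (lo i))^-1 * Y (hi i))).

Definition C_last : ratfun :=
  cst tnh^-1 * ((1 - cst (t0h * tnh) * Yn^-1) * (1 + cst (tnh / t0h) * Yn^-1)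
                / (1 - Yn ^- 2)).

Definition Fminus_first : ratfun :=
  (cst (unh^-1 - unh) + cst ((u0h^-1 - u0h) / qh) * Y1^-1) * (cst q * Y1 ^+ 2)
  / (1 - cst q * Y1 ^+ 2).

Definition Fplus_mid (i : 'I_m) : ratfun :=
  cst th^-1 * (cst (1 - t) / (1 - (Y (lo i))^-1 * Y (hi i))).

Definition Fplus_last : ratfun :=
  (cst (tnh^-1 - tnh) + cst (t0h^-1 - t0h) * Yn^-1) / (1 - Yn ^- 2).

(* The value of f at the point y: it does not depend on the presentation
   f = a / b with b(y) != 0, and is unspecified if there is none. *)
Definition value_at (y : 'I_m.+1 -> K) (f : ratfun) : K :=
  epsilon (inhabits 0) (fun c => exists a b : {mpoly K[m.+1]},
    [/\ b.@[y] != 0, f = tofrac a / tofrac b & c = a.@[y] / b.@[y]]).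

Definition ev_Y (mu : weight m) (j : 'I_m.+1) : K :=
  let vj := spt_int (v_ mu (false, j)) in
  q ^ (- mu j) * t ^ (- vj) * (t0h * tnh * t ^+ m.+1) ^ (sgz vj).

Definition ev (mu : weight m) (f : ratfun) : K := value_at (ev_Y mu) f.

(** ** The polynomials \hat E_mu *)

(* tau_k applied to \hat E_mu, on which f(Y) acts as the scalar ev_mu(f). *)
Definition tau_first (mu : weight m) (f : ratfun) : ratfun :=
  T0vee_inv f + cst (ev mu Fminus_first) * f.
Definition tau_mid (i : 'I_m) (mu : weight m) (f : ratfun) : ratfun :=
  T_mid i f + cst (ev mu (Fplus_mid i)) * f.
Definition tau_last (mu : weight m) (f : ratfun) : ratfun :=
  T_last f + cst (ev mu Fplus_last) * f.

(* The recursion reaches every mu in Z^n from 0, hence determines the family. *)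
Record is_Ehat (E : weight m -> ratfun) : Prop := IsEhat {
  Ehat_0 : E (weight0 m) = 1;
  Ehat_first : forall mu : weight m, mu ord0 <= 0 ->
    E (s_first mu) = tau_first mu (E mu);
  Ehat_mid : forall (i : 'I_m) (mu : weight m), mu (lo i) > mu (hi i) ->
    E (s_mid i mu) = tau_mid i mu (E mu);
  Ehat_last : forall mu : weight m, mu ord_max > 0 ->
    E (s_last mu) = tau_last mu (E mu) }.

End Koornwinder.

(** ** Generic parameters: the field of rational functions in them over C *)

Definition genK (R : realType) : fieldType := {fraction {mpoly R[i][6]}}.

Definition gen (R : realType) (k : nat) : genK R := tofrac 'X_(inord k).

Definition gen_params (R : realType) : params (genK R) :=
  Params (gen R 0) (gen R 1) (gen R 2) (gen R 3) (gen R 4) (gen R 5).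

(* Main.v *)
Require Import Defs.
From HB Require Import structures.
From mathcomp Require Import all_boot all_order all_fingroup all_algebra.
From mathcomp Require Import reals complex mpoly.
From mathcomp Require Import ring lra zify.

(** C and F^+ differ by the scalar t^(1/2) (for alpha_n, by t_n^(1/2)), so that for
    the reflections s_i with i >= 1 the formulas are the recursion with T_i written
    out, once the denominators of the evaluations are known not to vanish.  They do
    not, because the power of q in ev_mu(Y_j) is q^(- mu_j).

    The formula for s_0 has content.  Since Y_1 = T_0 T_1 .. T_n .. T_1, the
    operator of the recursion factors as (T_0^vee)^(-1) = X_1 T_0^(-1) Y_1, so on
    an eigenvector of Y_1 it is ev_mu(Y_1) X_1 T_0^(-1), where T_0^(-1) is explicit
    by the quadratic relation.  What has to be proved is therefore that \hat E_mu,
    known only through its recursion, is an eigenvector of Y_1; and the induction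
    along the recursion needs it to be an eigenvector of every Y_j, with
    eigenvalue ev_mu(Y_j).

    Each step of that induction is the usual intertwiner argument
    ([T_eig_lo], [T_eig_hi], [Tn_eig], [Bop_eig], [comm_eig]).  It rests on a short
    list of relations between the operators T_i and the multiplications X_i,
    collected in [hecke_rels]: the quadratic relations of T_0, .., T_n, of X_n T_n
    and of X_1 T_0^(-1), the braid relations among T_1, .., T_n, commutation of
    distant generators, and X_(i+1) = T_i X_i T_i.  The starting vector 1 is an
    eigenvector of every T_i, hence of every Y_j.  The steps attached to T_n and to
    (T_0^vee)^(-1) are one and the same rank one computation, [rank1_eig]: in both
    cases Y = A^(-1) Q with A and Q quadratic (A = U^(-1), Q = T_n, where U is
    conjugate to T_0; and A = X_1 T_0^(-1), Q = (T_0^vee)^(-1), which is conjugate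
    to X_n T_n).

    The relations are checked for operators f |-> a f + b s(f) on an arbitrary
    field with automorphisms s, where they become identities between a few
    rational functions ([refl_quad], [braid3_refl], [braid4_refl]), and are then
    transported to K(x) by showing that the substitutions xi_i are automorphisms.

    It remains to follow ev_mu along the recursion, that is, to know v_mu.  By the
    exchange condition, v_mu is the element that sorts the points +-1, .., +-n by
    the value of mu, ties being broken by the order 1 < .. < n < -n < .. < -1
    ([v_sorts], [sorts_uniq]).  Passing from mu to s_i mu then changes v_mu by s_i
    on the right, also for i = 0, where the point 1, which was first among those of
    value mu_1, is exchanged with -1, which becomes last among those of value
    mu_1 - 1 ([v_first]). *)

Set Implicit Arguments.
Unset Strict Implicit.
Unset Printing Implicit Defensive.

Import Order.TTheory GRing.Theory Num.Theory.
Local Open Scope ring_scope.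

(** * Reflection operators on a field with involutions *)

Section ReflectionOperators.

Variable F : fieldType.
Implicit Types (s r : {rmorphism F -> F}) (b c f x y z : F).

(** The shape of every T_i: c - b (1 - s), with s the reflection and c a square root
    of the Hecke parameter. *)
Definition dlop c b (s : F -> F) f : F := c * f - b * (f - s f).

Lemma dlopE c b (s : F -> F) f : dlop c b s f = (c - b) * f + b * s f.
Proof. by rewrite /dlop; ring. Qed.

Lemma eq_subr0 x y : x = y -> x - y = 0.
Proof. by move->; rewrite subrr. Qed.

(** The two hypotheses are the trace and the determinant of the operator P + Q s over
    the field fixed by s, so this is the Cayley-Hamilton identity. *)
Lemma refl_quad s P Q ga be :
  (forall f, s (s f) = f) -> P + s P = ga -> Q * s Q = be + P * s P ->
  forall f, P * (P * f + Q * s f) + Q * s (P * f + Q * s f)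
            = ga * (P * f + Q * s f) + be * f.
Proof.
move=> s2 tr nm f; rewrite rmorphD !rmorphM s2 -tr.
have -> : be = Q * s Q - P * s P by rewrite nm; ring.
ring.
Qed.

(** The coefficient b of T_i = c - b (1 - s_i), and below those of T_n and T_0. *)
Definition bmid c x y := c^-1 * ((y - c ^+ 2 * x) * (y - x)^-1).
Definition blast c u y :=
  c^-1 * ((1 + c / u * y) * (1 - c * u * y) * (1 - y ^+ 2)^-1).
Definition bfirst q c u x :=
  c^-1 * ((x + q * c / u) * (x - q * c * u) * (x ^+ 2 - q ^+ 2)^-1).

Lemma bmid_trace c x y : x != y -> c != 0 -> bmid c x y + bmid c y x = c + c^-1.
Proof.
move=> xy c0; rewrite /bmid; field.
by rewrite c0 !subr_eq0 xy eq_sym xy.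
Qed.

Lemma blast_trace c u y : y ^+ 2 != 1 -> y != 0 -> c != 0 -> u != 0 ->
  blast c u y + blast c u y^-1 = c + c^-1.
Proof.
move=> y2 y0 c0 u0; rewrite /blast.
by field; rewrite y0 u0 c0 !subr_eq0 y2 /= eq_sym.
Qed.

Lemma bfirst_trace q c u x :
  x ^+ 2 != q ^+ 2 -> x != 0 -> q != 0 -> c != 0 -> u != 0 ->
  bfirst q c u x + bfirst q c u (q ^+ 2 / x) = c + c^-1.
Proof.
move=> y2 y0 q0 c0 u0; rewrite /bfirst.
field; rewrite y0 u0 c0 !subr_eq0 y2 /= andbT.
rewrite (_ : _ + _ = q ^+ 2 * (q ^+ 2 - x ^+ 2)); last by ring.
by rewrite mulf_neq0 ?expf_neq0 // subr_eq0 eq_sym.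
Qed.

Lemma dlop1 c b (s : {rmorphism F -> F}) : dlop c b s 1 = c.
Proof. by rewrite /dlop rmorph1 subrr mulr0 subr0 mulr1. Qed.

Lemma dlop_quad s c b :
  (forall f, s (s f) = f) -> s c = c -> c != 0 -> b + s b = c + c^-1 ->
  forall f, dlop c b s (dlop c b s f) = (c - c^-1) * dlop c b s f + f.
Proof.
move=> s2 sc c0 tr f.
rewrite !dlopE (@refl_quad _ _ _ (c - c^-1) 1) ?mul1r //; rewrite rmorphB sc.
  by transitivity (c + c - (b + s b)); [ring | rewrite tr; ring].
transitivity (b * s b + c * (c + c^-1 - (b + s b))); first by rewrite tr; ring.
by rewrite mulrBr mulrDr mulfV //; ring.
Qed.

(** Both sides are combinations of the six elements of the group generated by s1 and
    s2; the last three hypotheses are the equalities of the coefficients of s1, s2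
    and 1, and those of the other elements agree identically. *)
Lemma braid3_refl (s1 s2 : {rmorphism F -> F}) (a b : F -> F -> F) x y z
    (T1 T2 : F -> F) :
  (forall f, s1 (s1 f) = f) -> (forall f, s2 (s2 f) = f) ->
  (forall f, s1 (s2 (s1 f)) = s2 (s1 (s2 f))) ->
  s1 x = y -> s1 y = x -> s1 z = z -> s2 x = x -> s2 y = z -> s2 z = y ->
  {morph s1 : u v / a u v} -> {morph s1 : u v / b u v} ->
  {morph s2 : u v / a u v} -> {morph s2 : u v / b u v} ->
  (forall f, T1 f = a x y * f + b x y * s1 f) ->
  (forall f, T2 f = a y z * f + b y z * s2 f) ->
  a x y * a y z + a x z * a y x = a y z * a x z ->
  a y z * a x y + a x z * a z y = a x y * a x z ->
  a x y * a y z * a x y + b x y * a x z * b y x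
   = a y z * a x y * a y z + b y z * a x z * b z y ->
  forall f, T1 (T2 (T1 f)) = T2 (T1 (T2 f)).
Proof.
move=> ss1 ss2 br x1 y1 z1 x2 y2 z2 s1a s1b s2a s2b E1 E2 k1 k2 k3 f.
rewrite !E1 !E2 !(rmorphD, rmorphM).
rewrite !(s1a, s2a, s1b, s2b, x1, y1, z1, x2, y2, z2, ss1, ss2, br).
move: k1 k2 k3 => /eq_subr0 k1 /eq_subr0 k2 /eq_subr0 k3.
apply/eqP; rewrite -subr_eq0; apply/eqP.
(* the zeros are the differences of coefficients k3, k1, k2 *)
transitivity (0 * f + b x y * 0 * s1 f - b y z * 0 * s2 f); last by ring.
by rewrite -{1}k3 -{1}k1 -k2; ring.
Qed.

(** As for [braid3_refl], with the eight elements of the group of type B_2.  The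
    homogeneity of a and b gives the coefficients of r s r and s r s r; the last four
    hypotheses compare the coefficients of r s, s r, r and s. *)
Lemma braid4_refl (s r : {rmorphism F -> F}) (a b : F -> F -> F) (e d : F -> F) x y
    (T1 T2 : F -> F) :
  (forall f, s (s f) = f) -> (forall f, r (r f) = f) ->
  (forall f, s (r (s (r f))) = r (s (r (s f)))) ->
  s x = y -> s y = x -> r x = x -> r y = y^-1 ->
  {morph s : u v / a u v} -> {morph s : u v / b u v} ->
  {morph r : u v / a u v} -> {morph r : u v / b u v} ->
  {morph s : u / e u} -> {morph s : u / d u} ->
  {morph r : u / e u} -> {morph r : u / d u} ->
  (forall f, T1 f = a x y * f + b x y * s f) ->
  (forall f, T2 f = e y * f + d y * r f) ->
  a x y = a y^-1 x^-1 -> b x y = b y^-1 x^-1 -> b x y^-1 = b y x^-1 ->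
  a x y * e x = e y * a x y + a x y^-1 * e y^-1 + e x * a y^-1 x ->
  e y * a y x^-1 = a x y * e y + e x * a y x + a y x^-1 * e x^-1 ->
  a x y * a x y * e y + a x y * a x y^-1 * e y^-1 + b x y * b y x * e x
  = e y * a x y * a x y^-1 + a x y^-1 * a x y^-1 * e y^-1
    + b x y^-1 * b y^-1 x * e x ->
  a x y * e y * e x + e x * a y x * e x + d x * d x^-1 * a y x^-1
  = e y * a x y * e y + e y * e x * a y x + d y * d y^-1 * a x y^-1 ->
  forall f, T1 (T2 (T1 (T2 f))) = T2 (T1 (T2 (T1 f))).
Proof.
move=> ss rr br sx sy rx ry sa sb ra rb se sd re rd E1 E2 ha hb hb' k1 k2 k3 k4 f.
rewrite !E1 !E2 !(rmorphD, rmorphM).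
rewrite !(sa, sb, sd, se, ra, rb, rd, re, sx, sy, rx, ry, fmorphV, invrK, ss, rr, br).
rewrite -ha -hb -hb'.
move: k1 k2 k3 k4 => /eq_subr0 k1 /eq_subr0 k2 /eq_subr0 k3 /eq_subr0 k4.
apply/eqP; rewrite -subr_eq0; apply/eqP.
transitivity (d y * b x y^-1 * 0 * r (s f) - b x y * d x * 0 * s (r f)
  + d y * 0 * r f + b x y * 0 * s f); last by ring.
by rewrite -{1}k1 -{1}k2 -{1}k3 -k4; ring.
Qed.

Lemma rmorph_bmid (s : {rmorphism F -> F}) c : s c = c -> {morph s : u v / bmid c u v}.
Proof.
by move=> sc u v; rewrite /bmid !(rmorphM, rmorphB, fmorphV, rmorphXn) sc.
Qed.

Lemma rmorph_blast (s : {rmorphism F -> F}) c u : s c = c -> s u = u ->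
  {morph s : y / blast c u y}.
Proof.
move=> sc su y.
by rewrite /blast !(rmorphM, rmorphB, fmorphV, rmorphXn, rmorphD, rmorph1) sc su.
Qed.

Lemma braid_mid (s1 s2 : {rmorphism F -> F}) c x y z :
  (forall f, s1 (s1 f) = f) -> (forall f, s2 (s2 f) = f) ->
  (forall f, s1 (s2 (s1 f)) = s2 (s1 (s2 f))) ->
  s1 c = c -> s2 c = c ->
  s1 x = y -> s1 y = x -> s1 z = z -> s2 x = x -> s2 y = z -> s2 z = y ->
  c != 0 -> x != y -> y != z -> x != z ->
  let T1 := dlop c (bmid c x y) s1 in
  let T2 := dlop c (bmid c y z) s2 in
  forall f, T1 (T2 (T1 f)) = T2 (T1 (T2 f)).
Proof.
move=> ss1 ss2 br c1 c2 x1 y1 z1 x2 y2 z2 c0 xy yz xz T1 T2.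
have nz := (subr_eq0, c0, eq_sym z, eq_sym y x, xy, yz, xz).
apply: (@braid3_refl s1 s2 (fun u v => c - bmid c u v) (bmid c) x y z) => //.
- by move=> u v; rewrite rmorphB (rmorph_bmid c1) c1.
- exact: rmorph_bmid.
- by move=> u v; rewrite rmorphB (rmorph_bmid c2) c2.
- exact: rmorph_bmid.
- by move=> f; rewrite /T1 dlopE.
- by move=> f; rewrite /T2 dlopE.
- by rewrite /bmid; field; rewrite !nz.
- by rewrite /bmid; field; rewrite !nz.
- by rewrite /bmid; field; rewrite !nz.
Qed.

(** This form and the next one make the identities of [braid_last] small: b enters
    only through a = c - b and through products b s(b), whose value 1 + a s(a) is the
    determinant condition of the quadratic relation. *)
Lemma bmid_compl c u v : c != 0 -> u != v -> c - bmid c u v = (c - c^-1) * (v / (v - u)).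
Proof. by move=> c0 uv; rewrite /bmid; field; rewrite c0 subr_eq0 eq_sym uv. Qed.

Lemma bmid_norm c u v : c != 0 -> u != v ->
  bmid c u v * bmid c v u = 1 + (c - bmid c u v) * (c - bmid c v u).
Proof.
by move=> c0 uv; rewrite /bmid; field; rewrite c0 !subr_eq0 uv eq_sym uv.
Qed.

Lemma blast_compl c u y : c != 0 -> u != 0 -> y ^+ 2 != 1 ->
  c - blast c u y = ((c - c^-1) + (u - u^-1) * y) / (1 - y ^+ 2).
Proof.
by move=> c0 u0 y2; rewrite /blast; field; rewrite c0 u0 subr_eq0 eq_sym y2.
Qed.

Lemma blast_norm c u y : c != 0 -> u != 0 -> y != 0 -> y ^+ 2 != 1 ->
  blast c u y * blast c u y^-1 = 1 + (c - blast c u y) * (c - blast c u y^-1).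
Proof.
move=> c0 u0 y0 y2; rewrite /blast; field.
by rewrite c0 u0 y0 !subr_eq0 y2 eq_sym y2.
Qed.

Lemma braid_last (s r : {rmorphism F -> F}) t c u x y :
  (forall f, s (s f) = f) -> (forall f, r (r f) = f) ->
  (forall f, s (r (s (r f))) = r (s (r (s f)))) ->
  s t = t -> r t = t -> s c = c -> r c = c -> s u = u -> r u = u ->
  s x = y -> s y = x -> r x = x -> r y = y^-1 ->
  t != 0 -> c != 0 -> u != 0 ->
  x != 0 -> y != 0 -> x != y -> x ^+ 2 != 1 -> y ^+ 2 != 1 -> x * y != 1 ->
  let T1 := dlop t (bmid t x y) s in
  let T2 := dlop c (blast c u y) r in
  forall f, T1 (T2 (T1 (T2 f))) = T2 (T1 (T2 (T1 f))).
Proof.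
move=> ss rr br st rt sc rc su ru sx sy rx ry t0 c0 u0 x0 y0 xy x2 y2 xy1 T1 T2.
have xVy : x != y^-1 by apply: contra_neq xy1 => ->; rewrite mulVf.
have yVx : y != x^-1 by apply: contra_neq xy1 => ->; rewrite mulfV.
have yV2 : y^-1 ^+ 2 != 1 by rewrite exprVn invr_eq1.
have xV2 : x^-1 ^+ 2 != 1 by rewrite exprVn invr_eq1.
have yV0 : y^-1 != 0 by rewrite invr_eq0.
have xV0 : x^-1 != 0 by rewrite invr_eq0.
have Vyx : y^-1 != x by rewrite eq_sym.
have Vxy : x^-1 != y by rewrite eq_sym.
have yx : y != x by rewrite eq_sym.
have xyB : x * y - 1 != 0 by rewrite subr_eq0.
have xyB' : 1 - x * y != 0 by rewrite subr_eq0 eq_sym.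
have nz := (mulNr, mul1r, mulrC y x, eq_sym (1 : F), subr_eq0, c0, u0, t0, x0, y0,
  xy, yx, x2, y2, xyB, xyB', xy1).
apply: (@braid4_refl s r (fun u v => t - bmid t u v) (bmid t)
  (fun v => c - blast c u v) (blast c u) x y) => //.
- by move=> ? ?; rewrite rmorphB (rmorph_bmid st) st.
- exact: rmorph_bmid.
- by move=> ? ?; rewrite rmorphB (rmorph_bmid rt) rt.
- exact: rmorph_bmid.
- by move=> ?; rewrite rmorphB (rmorph_blast sc su) sc.
- exact: rmorph_blast.
- by move=> ?; rewrite rmorphB (rmorph_blast rc ru) rc.
- exact: rmorph_blast.
- by move=> ?; rewrite /T1 dlopE.
- by move=> ?; rewrite /T2 dlopE.
- by rewrite /bmid; field; rewrite !nz.
- by rewrite /bmid; field; rewrite !nz.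
- by rewrite /bmid; field; rewrite !nz.
- by rewrite !bmid_compl ?blast_compl //; field; rewrite !nz.
- by rewrite !bmid_compl ?blast_compl //; field; rewrite !nz.
- by rewrite !bmid_norm ?bmid_compl ?blast_compl //; field; rewrite !nz.
- by rewrite !blast_norm ?bmid_compl ?blast_compl //; field; rewrite !nz.
Qed.

(** The quadratic relation of X_n T_n, where the parameter u_n appears. *)
Lemma mul_last_quad (r : {rmorphism F -> F}) c u y :
  (forall f, r (r f) = f) -> r c = c -> r u = u -> r y = y^-1 ->
  y ^+ 2 != 1 -> y != 0 -> c != 0 -> u != 0 ->
  let R f := y * dlop c (blast c u y) r f in
  forall f, R (R f) = (u^-1 - u) * R f + f.
Proof.
move=> rr rc ru ry y2 y0 c0 u0 R f.
have yV2 : y^-1 ^+ 2 != 1 by rewrite exprVn invr_eq1.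
have yV0 : y^-1 != 0 by rewrite invr_eq0.
have E g : R g = (y * (c - blast c u y)) * g + (y * blast c u y) * r g.
  by rewrite /R dlopE; ring.
have rb := rmorph_blast rc ru.
rewrite !E (@refl_quad _ _ _ (u^-1 - u) 1) ?mul1r //.
  rewrite rmorphM rmorphB rc rb ry !blast_compl //; field.
  by rewrite !(eq_sym (1 : F), subr_eq0, y0, u0, c0, y2).
have rM v : r (y * v) = y^-1 * r v by rewrite rmorphM ry.
rewrite !rM rmorphB rc rb ry mulrACA mulfV // blast_norm //.
by rewrite mulrACA mulfV //; ring.
Qed.

(** The quadratic relation of X_1 T_0^(-1), where the parameter u_0 appears. *)
Lemma mul_first_quad (r : {rmorphism F -> F}) q c u x :
  (forall f, r (r f) = f) -> r q = q -> r c = c -> r u = u -> r x = q ^+ 2 / x ->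
  x ^+ 2 != q ^+ 2 -> x != 0 -> q != 0 -> c != 0 -> u != 0 ->
  let R f := x * (dlop c (bfirst q c u x) r f - (c - c^-1) * f) in
  forall f, R (R f) = ((u - u^-1) * q) * R f + q ^+ 2 * f.
Proof.
move=> rr rq rc ru rx x2 x0 q0 c0 u0 R f.
set b := bfirst q c u.
have rb v : r (b v) = b (r v).
  by rewrite /b /bfirst !(rmorphM, rmorphB, fmorphV, rmorphXn, rmorphD) rq rc ru.
have E g : R g = (x * (c^-1 - b x)) * g + (x * b x) * r g.
  by rewrite /R dlopE /b; ring.
have tr : b x + b (q ^+ 2 / x) = c + c^-1 by apply: bfirst_trace.
have E' : b (q ^+ 2 / x) = c + c^-1 - b x by rewrite -tr; ring.
rewrite !E (@refl_quad _ _ _ ((u - u^-1) * q) (q ^+ 2)) //.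
  rewrite rmorphM rmorphB fmorphV rc rb rx E' /b /bfirst; field.
  by rewrite x0 u0 c0 subr_eq0 x2.
have rM v : r (x * v) = q ^+ 2 / x * r v by rewrite rmorphM rx.
rewrite !rM rmorphB fmorphV rc rb rx E'.
by field; rewrite c0.
Qed.

(** The relation T_i X_i T_i = X_(i+1). *)
Lemma dlop_shift (s : {rmorphism F -> F}) c x y :
  (forall f, s (s f) = f) -> s c = c -> s x = y -> s y = x -> c != 0 -> x != y ->
  let T := dlop c (bmid c x y) s in forall f, T (x * T f) = y * f.
Proof.
move=> ss sc sx sy c0 xy T f; rewrite /T !dlopE.
set a := c - bmid c x y; set b := bmid c x y.
have sa : s a = c - bmid c y x by rewrite rmorphB (rmorph_bmid sc) sc sx sy.
have sb : s b = bmid c y x by rewrite (rmorph_bmid sc) sx sy.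
have yx : y != x by rewrite eq_sym.
have bb : b * s b = 1 + a * s a by rewrite sa sb bmid_norm.
have ax : a * x + y * s a = 0.
  by rewrite sa /a !bmid_compl //; field; rewrite c0 !subr_eq0 xy yx.
clearbody a b; clear sa sb.
rewrite rmorphM rmorphD !rmorphM ss sx.
transitivity (y * f + (a * x + y * s a) * (a * f + b * s f)
   + y * (b * s b - (1 + a * s a)) * f); first by ring.
by rewrite bb ax subrr; ring.
Qed.

Lemma dlop_comm (s r : {rmorphism F -> F}) c b c' b' :
  (forall f, s (r f) = r (s f)) -> s c' = c' -> s b' = b' -> r c = c -> r b = b ->
  forall f, dlop c b s (dlop c' b' r f) = dlop c' b' r (dlop c b s f).
Proof.
move=> sr sc sb rc rb f.
by rewrite !dlopE !rmorphD !rmorphM !rmorphB sc sb rc rb sr; ring.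
Qed.

Lemma dlop_mul (s : {rmorphism F -> F}) c b x f :
  s x = x -> x * dlop c b s f = dlop c b s (x * f).
Proof. by move=> sx; rewrite !dlopE rmorphM sx; ring. Qed.

Lemma dlop_partial c p d f (s : F -> F) : c != 0 ->
  c^-1 * (c ^+ 2 * f - p * (d^-1 * (f - s f))) = dlop c (c^-1 * (p * d^-1)) s f.
Proof.
move=> c0; rewrite /dlop mulrBr; congr (_ - _); first by field.
by rewrite !mulrA.
Qed.

End ReflectionOperators.

(** * Affine Hecke relations and intertwiners *)

Section OperatorCommutation.

Variable V : Type.
Implicit Types P Q : V -> V.

Definition opcomm P Q := forall f, P (Q f) = Q (P f).

Lemma opcommC P Q : opcomm P Q -> opcomm Q P.
Proof. by move=> h f; rewrite h. Qed.

Lemma opcomm_inv P Q Q' : cancel Q Q' -> cancel Q' Q -> opcomm P Q -> opcomm P Q'.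
Proof. by move=> QK QK' h f; rewrite -{2}(QK' f) h QK. Qed.

End OperatorCommutation.

Section AffineHecke.

Variables (K F : fieldType) (io : {rmorphism K -> F}).

Definition klinear (P : F -> F) :=
  forall c f g, P (io c * f + g) = io c * P f + P g.

Lemma klinearZ P c f : klinear P -> P (io c * f) = io c * P f.
Proof.
move=> lP; have P0 : P 0 = 0.
  by have := lP (-1) 0 0; rewrite mulr0 addr0 rmorphN1 mulN1r addNr.
by rewrite -[io c * f]addr0 lP P0 addr0.
Qed.

(** The inverse of an operator with P^2 = b P + 1. *)
Definition heckeV b (P : F -> F) f := P f - io b * f.

Lemma klinear_heckeV b P : klinear P -> klinear (heckeV b P).
Proof. by move=> lP c f g; rewrite /heckeV lP; ring. Qed.

Definition hecke_quad b (P : F -> F) := forall f, P (P f) = io b * P f + f.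

Lemma heckeVK b P : klinear P -> hecke_quad b P -> cancel (heckeV b P) P.
Proof.
move=> lP qP f; rewrite /heckeV addrC -mulNr -rmorphN lP qP rmorphN.
by ring.
Qed.

Lemma heckeV_quad b P : klinear P -> hecke_quad b P ->
  forall f, heckeV b P (heckeV b P f) = io (- b) * heckeV b P f + io 1 * f.
Proof.
move=> lP qP f; rewrite {1}/heckeV heckeVK // /heckeV rmorphN rmorph1; ring.
Qed.

Lemma heckeKV b P : hecke_quad b P -> cancel P (heckeV b P).
Proof. by move=> qP f; rewrite /heckeV qP; ring. Qed.

Variable m : nat.
Variables (T X : nat -> F -> F) (S Tn : F -> F).
Variables (b b0 bn ga al q : K).

(** The relations used below, with indices shifted down by one: T k is T_(k+1) and X k
    is the multiplication by x_(k+1), S stands for T_0 and Tn for T_n. *)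
Record hecke_rels : Prop := HeckeRels {
  T_lin : forall k, (k < m)%N -> klinear (T k);
  X_lin : klinear (X 0);
  S_lin : klinear S;
  Tn_lin : klinear Tn;
  T_quad : forall k, (k < m)%N -> hecke_quad b (T k);
  S_quad : hecke_quad b0 S;
  Tn_quad : hecke_quad bn Tn;
  XTn_quad : hecke_quad ga (X m \o Tn);
  XS_quad : forall f,
    let A f := X 0 (heckeV b0 S f) in A (A f) = io al * A f + io q * f;
  T_comm : forall i j, (i.+1 < j < m)%N -> opcomm (T i) (T j);
  T_braid : forall i, (i.+1 < m)%N ->
    forall f, T i (T i.+1 (T i f)) = T i.+1 (T i (T i.+1 f));
  TTn_comm : forall i, (i.+1 < m)%N -> opcomm (T i) Tn;
  TTn_braid : forall i, i.+1 = m ->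
    forall f, T i (Tn (T i (Tn f))) = Tn (T i (Tn (T i f)));
  ST_comm : forall i, (0 < i < m)%N -> opcomm S (T i);
  STn_comm : (0 < m)%N -> opcomm S Tn;
  XT_comm : forall i, (0 < i < m)%N -> opcomm (X 0) (T i);
  XTn_comm : (0 < m)%N -> opcomm (X 0) Tn;
  SX_comm : (0 < m)%N -> opcomm S (X 1%N);
  TXT : forall i, (i < m)%N -> forall f, T i (X i (T i f)) = X i.+1 f }.

Hypothesis H : hecke_rels.

Definition Ti k := heckeV b (T k).

Let TiK k : (k < m)%N -> cancel (Ti k) (T k).
Proof. by move=> km; apply: heckeVK; [apply: T_lin | apply: T_quad]. Qed.
Let TKi k : (k < m)%N -> cancel (T k) (Ti k).
Proof. by move=> km; apply: heckeKV; apply: T_quad. Qed.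
Let Ti_lin k : (k < m)%N -> klinear (Ti k).
Proof. by move=> km; apply: klinear_heckeV; apply: T_lin. Qed.

Lemma opcomm_Ti P k : (k < m)%N -> opcomm P (T k) -> opcomm P (Ti k).
Proof. by move=> km; apply: opcomm_inv; [apply: TKi | apply: TiK]. Qed.

(** The palindrome T_(m-r) .. T_(m-1) Tn T_(m-1) .. T_(m-r), by recursion on its number
    of layers. *)
Fixpoint pal_rec r : F -> F :=
  if r is r'.+1 then fun f => T (m - r) (pal_rec r' (T (m - r) f)) else Tn.
Definition pal k := pal_rec (m - k).

Lemma pal_m : pal m = Tn. Proof. by rewrite /pal subnn. Qed.

Lemma palE k f : (k < m)%N -> pal k f = T k (pal k.+1 (T k f)).
Proof.
move=> km; rewrite /pal -[(m - k)%N]prednK ?subn_gt0 //= prednK ?subn_gt0 //.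
by rewrite subKn ?subnS // ltnW.
Qed.

(** Induction from m down to 0, the direction in which palindromes grow. *)
Lemma down_ind (P : nat -> Prop) : P m -> (forall k, (k < m)%N -> P k.+1 -> P k) ->
  forall k, (k <= m)%N -> P k.
Proof.
move=> Pm Pk k km; rewrite -(subKn km); elim: (m - k)%N (leq_subr k m) => [|r IH] rm.
  by rewrite subn0.
by apply: Pk; [lia | rewrite subnSK //; apply: IH; lia].
Qed.

Lemma pal_lin k : (k <= m)%N -> klinear (pal k).
Proof.
move: k; apply: down_ind => [|k km IH]; first by rewrite pal_m; apply: Tn_lin.
by move=> c f g; rewrite !(palE _ km) (T_lin H) // IH (T_lin H).
Qed.

Lemma opcomm_pal P k : (k <= m)%N -> opcomm P Tn ->
  (forall i, (k <= i < m)%N -> opcomm P (T i)) -> opcomm P (pal k).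
Proof.
move=> km hn; move: k km; apply: down_ind => [|k km IH] hT; first by rewrite pal_m.
have kk : opcomm P (T k) by apply: hT; rewrite leqnn.
move=> f; rewrite !(palE _ km) kk IH ?kk // => i /andP[ki im]; apply: hT.
by rewrite im ltnW.
Qed.

(** Inside the palindrome, T_i meets T_(i-1) T_i on the left and T_i T_(i-1) on the right;
    the two braid moves turn it into T_(i-1), which crosses the core, and back into T_i. *)
Lemma T_pal_comm i k : (k <= m)%N -> (k < i < m)%N -> opcomm (T i) (pal k).
Proof.
move=> km; move: k km; apply: down_ind => [|k km IH]; first by lia.
move=> /andP[ki im]; case: (ltnP k.+1 i) => [ki1|ik].
  have c : opcomm (T i) (T k) by apply/opcommC/(T_comm H); rewrite ki1.
  by move=> f; rewrite !(palE _ km) c IH ?c // ki1.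
have {ik ki} ? : i = k.+1 by lia.
subst i.
have c : opcomm (T k) (pal k.+2).
  apply: opcomm_pal => //; first exact: (TTn_comm H).
  by move=> j /andP[kj jm]; apply: (T_comm H); rewrite kj.
by move=> f; rewrite !(palE _ km) !(palE _ im) -!(T_braid H) // c (T_braid H).
Qed.

Lemma Tn_pal_comm k : (k < m)%N -> opcomm Tn (pal k).
Proof.
move=> km; have km' := ltnW km; move: k km' km; apply: down_ind => [|k km' IH _].
  by rewrite ltnn.
case: (ltnP k.+1 m) => [km1|mk] f.
  have c : opcomm Tn (T k) by apply/opcommC/(TTn_comm H).
  by rewrite !(palE _ km') c IH // c.
have e : k.+1 = m by lia.
by rewrite !(palE _ km') e pal_m -(TTn_braid H).
Qed.

Fixpoint Yop j : F -> F :=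
  if j is j'.+1 then fun f => Ti j' (Yop j' (Ti j' f)) else fun f => S (pal 0 f).

Lemma Yop_lin j : (j <= m)%N -> klinear (Yop j).
Proof.
elim: j => [_|j IH jm] c f g /=; first by rewrite (pal_lin (leq0n _)) (S_lin H).
by rewrite (Ti_lin jm) IH ?(Ti_lin jm) // ltnW.
Qed.

Lemma opcomm_Yop P i j : (i <= j)%N -> (j <= m)%N -> opcomm P (Yop i) ->
  (forall k, (i <= k < j)%N -> opcomm P (T k)) -> opcomm P (Yop j).
Proof.
move=> ij jm hi; elim: j ij jm => [|j IH] ij jm hT; first by move: ij hi; rewrite leqn0 => /eqP->.
case: (ltnP j i) => [ji|ij']; first by have <- : i = j.+1 by lia.
have c : opcomm P (Ti j) by apply: opcomm_Ti => //; apply: hT; rewrite ij' ltnSn.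
move=> f /=; rewrite c IH // ?c //; first exact: ltnW.
by move=> k /andP[ik kj]; apply: hT; rewrite ik ltnS ltnW.
Qed.

Lemma T_Yop0_comm i : (0 < i < m)%N -> opcomm (T i) (Yop 0).
Proof.
move=> im f /=; rewrite -(ST_comm H) // T_pal_comm //.
Qed.

(** For j below i, the operator T_i commutes with Y_1 and with the T_k that conjugate it
    into Y_j.  For j above i + 1, two braid moves turn it into T_(i+1), which commutes
    with Y_i by the first case. *)
Lemma T_Yop_comm i j : (i < m)%N -> (j <= m)%N -> j != i -> j != i.+1 -> opcomm (T i) (Yop j).
Proof.
move=> im jm ji ji1; case: (ltnP i j) => [ij|{}ji'].
  have ij2 : (i.+2 <= j)%N by lia.
  apply: (opcomm_Yop ij2 jm) => [|k /andP[ik kj]]; last first.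
    by apply: (T_comm H); rewrite ik (leq_trans kj).
  have i1m : (i.+1 < m)%N by lia.
  have c : opcomm (T i.+1) (Yop i).
    apply: (@opcomm_Yop _ 0) => //; first exact: ltnW.
      by apply: T_Yop0_comm; lia.
    by move=> k /andP[_ ki]; apply/opcommC/(T_comm H); rewrite i1m andbT ltnS.
  (* T_i T_{i+1}^{-1} T_i^{-1} = T_{i+1}^{-1} T_i^{-1} T_{i+1} *)
  have br f : T i (Ti i.+1 (Ti i f)) = Ti i.+1 (Ti i (T i.+1 f)).
    apply: (can_inj (TKi i1m)); apply: (can_inj (TKi im)).
    by rewrite (T_braid H) // !TiK.
  have br' f : T i.+1 (Ti i (Ti i.+1 f)) = Ti i (Ti i.+1 (T i f)).
    apply: (can_inj (TKi im)); rewrite TiK //; apply: (can_inj (TKi i1m)).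
    by rewrite -(T_braid H) // !TiK.
  by move=> f /=; rewrite br c br'.
have ij : (j < i)%N by lia.
apply: (@opcomm_Yop _ 0) => //; first by apply: T_Yop0_comm; lia.
by move=> k /andP[_ kj]; apply/opcommC/(T_comm H); rewrite im andbT; lia.
Qed.

Lemma Tn_Yop_comm j : (j < m)%N -> opcomm Tn (Yop j).
Proof.
move=> jm; apply: (@opcomm_Yop _ 0) => //; first exact: ltnW.
  have m0 : (0 < m)%N by lia.
  by move=> f /=; rewrite -(STn_comm H) // Tn_pal_comm.
by move=> k /andP[_ kj]; apply/opcommC/(TTn_comm H); lia.
Qed.

Lemma hecke_quad_conj be P k : (k < m)%N -> hecke_quad be P ->
  hecke_quad be (fun f => Ti k (P (T k f))).
Proof. by move=> km qP f; rewrite TiK // qP (Ti_lin km) TKi. Qed.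

(** Defined so that Y_j = U_j [pal j] ([Yop_Uop_pal]); being a conjugate of T_0, it is
    quadratic with the parameter of T_0. *)
Fixpoint Uop j : F -> F :=
  if j is j'.+1 then fun f => Ti j' (Uop j' (T j' f)) else S.

Lemma Uop_quad j : (j <= m)%N -> hecke_quad b0 (Uop j).
Proof.
elim: j => [_|j IH jm]; first exact: (S_quad H).
by apply: hecke_quad_conj => //; apply: IH; apply: ltnW.
Qed.

Lemma Uop_lin j : (j <= m)%N -> klinear (Uop j).
Proof.
elim: j => [_|j IH jm] c f g /=; first exact: (S_lin H).
by rewrite (T_lin H jm) (IH (ltnW jm)) (Ti_lin jm).
Qed.

Lemma Yop_Uop_pal j f : (j <= m)%N -> Yop j f = Uop j (pal j f).
Proof.
elim: j f => [//|j IH] f jm /=.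
by rewrite IH ?(ltnW jm) // palE // TiK.
Qed.

(** The operator (T_0^vee)^(-1). *)
Definition Bop f := X 0 (pal 0 f).

(** By X_(i+1) = T_i X_i T_i, the operators X_k [pal k] are conjugate to each other, and
    the last of them is X_n T_n. *)
Lemma Bop_quad : hecke_quad ga Bop.
Proof.
suff h k : (k <= m)%N -> hecke_quad ga (fun f => X k (pal k f)) by exact: h.
move: k; apply: down_ind => [|k km IH]; first by move=> f /=; rewrite pal_m; exact: (XTn_quad H).
have e f : X k (pal k f) = Ti k (X k.+1 (pal k.+1 (T k f))).
  by rewrite -(TXT H) // TKi // palE.
by move=> f; rewrite !e (hecke_quad_conj km IH).
Qed.

Lemma Bop_lin : klinear Bop.
Proof. by move=> c f g; rewrite /Bop (pal_lin (leq0n _)) (X_lin H). Qed.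

Lemma Bop_T_comm k : (0 < k < m)%N -> opcomm Bop (T k).
Proof.
by move=> km f; rewrite /Bop -T_pal_comm // (XT_comm H).
Qed.

Lemma S_pal1_comm : (0 < m)%N -> opcomm S (pal 1).
Proof.
move=> m0; apply: opcomm_pal => //; first exact: (STn_comm H).
by move=> i im; apply: (ST_comm H).
Qed.

(** Conjugation by T_1 (here T 0) turns the operator into X_2 T_2 .. T_n .. T_2, and T_0,
    which acts on x_1 only, commutes with every factor of this product. *)
Lemma Bop_TST_comm : (0 < m)%N -> opcomm Bop (fun f => Ti 0 (S (T 0 f))).
Proof.
move=> m0 f; rewrite /Bop !(@palE 0) // TiK //.
apply: (can_inj (TKi m0)); rewrite TiK //.
by rewrite !(TXT H) // (SX_comm H) // S_pal1_comm.
Qed.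

(** It suffices to treat Y_2 = (T_1^(-1) T_0 T_1) (T_2 .. T_n .. T_2), whose two factors
    commute with (T_0^vee)^(-1). *)
Lemma Bop_Yop_comm j : (0 < j <= m)%N -> opcomm Bop (Yop j).
Proof.
move=> /andP[j0 jm]; have m0 : (0 < m)%N by lia.
apply: (@opcomm_Yop _ 1) => //; last by move=> k /andP[k1 kj]; apply: Bop_T_comm; lia.
have BL1 : opcomm Bop (pal 1).
  apply: opcomm_pal => //; last by move=> i im; apply: Bop_T_comm.
  by move=> f; rewrite /Bop -(Tn_pal_comm m0) (XTn_comm H).
by move=> f; rewrite !(@Yop_Uop_pal 1) //= (Bop_TST_comm m0) BL1.
Qed.

Variables (E : F) (e : nat -> K).
Hypothesis eigE : forall j, (j <= m)%N -> Yop j E = io (e j) * E.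
Hypothesis e0 : forall j, (j <= m)%N -> e j != 0.

Lemma comm_eig P c j : klinear P -> (j <= m)%N -> opcomm P (Yop j) ->
  Yop j (P E + io c * E) = io (e j) * (P E + io c * E).
Proof.
move=> lP jm cm; rewrite addrC (Yop_lin jm) -cm eigE // (klinearZ _ _ lP); ring.
Qed.

(** The condition on c is what makes the coefficient of E vanish; the same holds in the
    following lemmas. *)
Lemma T_eig_lo i c : (i < m)%N -> c * (e i - e i.+1) = - b * e i ->
  Yop i (T i E + io c * E) = io (e i.+1) * (T i E + io c * E).
Proof.
move=> im hc; rewrite addrC (Yop_lin (ltnW im)) eigE ?(ltnW im) //.
have y1 : Ti i (Yop i (Ti i E)) = io (e i.+1) * E by exact: (eigE im).
have -> : Yop i (T i E) = io b * (io (e i) * E) + io (e i.+1) * T i E.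
  rewrite -eigE ?(ltnW im) // -(klinearZ _ _ (T_lin H im)) -y1 TiK //.
  rewrite -(Yop_lin (ltnW im)); congr (Yop i _).
  by rewrite /Ti /heckeV; ring.
have : io (c * (e i - e i.+1)) = io (- b * e i) by rewrite hc.
rewrite !(rmorphM, rmorphB, rmorphN) => h.
transitivity (io (e i.+1) * (T i E + io c * E)
   + (io c * (io (e i) - io (e i.+1)) + io b * io (e i)) * E); first by ring.
by rewrite h; ring.
Qed.

Lemma T_eig_hi i c : (i < m)%N -> c * (e i - e i.+1) = - b * e i ->
  Yop i.+1 (T i E + io c * E) = io (e i) * (T i E + io c * E).
Proof.
move=> im hc; rewrite addrC (Yop_lin im) eigE //.
have -> : Yop i.+1 (T i E) = io (e i) * (T i E - io b * E).
  by rewrite /= TKi // eigE ?(ltnW im) // (klinearZ _ _ (Ti_lin im)).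
have : io (c * (e i - e i.+1)) = io (- b * e i) by rewrite hc.
rewrite !(rmorphM, rmorphB, rmorphN) => h.
transitivity (io (e i) * (T i E + io c * E)
   - (io c * (io (e i) - io (e i.+1)) + io b * io (e i)) * E); first by ring.
by rewrite h; ring.
Qed.

(** A rank one intertwiner: Y1 = A^(-1) Q with A and Q quadratic.  The eigenvalue ev is
    exchanged with 1 / (q1 ev), where - q1 is the determinant of A. *)
Lemma rank1_eig (A Q Y1 : F -> F) x q1 y c ev : klinear A -> klinear Y1 ->
  (forall f, A (A f) = io x * A f + io q1 * f) -> hecke_quad y Q ->
  (forall f, A (Y1 f) = Q f) -> q1 != 0 -> ev != 0 -> Y1 E = io ev * E ->
  c * (q1^-1 * ev^-1 - ev) = y * ev - q1^-1 * x ->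
  Y1 (Q E + io c * E) = io (q1^-1 * ev^-1) * (Q E + io c * E).
Proof.
move=> lA lY qA qQ AY q10 ev0 YE hc.
have iq0 : io q1 != 0 by rewrite fmorph_eq0.
have ie0 : io ev != 0 by rewrite fmorph_eq0.
(* A (A - x) = q1 is invertible *)
have Ainj : injective A.
  move=> f g fg; apply: (mulfI iq0); apply: (addrI (io x * A f)).
  by rewrite -qA {2}fg -qA fg.
have QE : Q E = io ev * A E by rewrite -AY YE (klinearZ _ _ lA).
have YQ : Y1 (Q E) = io (y * ev) * E + io q1^-1 * (A E - io x * E).
  have AA : A (A E - io x * E) = io q1 * E.
    by rewrite addrC -mulNr -rmorphN lA qA rmorphN; ring.
  apply: Ainj; rewrite AY qQ lA (klinearZ _ _ lA) AA QE.
  by rewrite rmorphM fmorphV; field.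
rewrite addrC lY YE YQ.
have : io (c * (q1^-1 * ev^-1 - ev)) = io (y * ev - q1^-1 * x) by rewrite hc.
rewrite QE !(rmorphM, rmorphB, fmorphV) => h.
transitivity ((io q1)^-1 * (io ev)^-1 * (io ev * A E + io c * E)
   + ((io y * io ev - (io q1)^-1 * io x)
      - io c * ((io q1)^-1 * (io ev)^-1 - io ev)) * E); first by field; rewrite iq0 ie0.
by rewrite h; ring.
Qed.

Lemma Tn_eig c : c * ((e m)^-1 - e m) = b0 + bn * e m ->
  Yop m (Tn E + io c * E) = io (e m)^-1 * (Tn E + io c * E).
Proof.
move=> hc; have lU := Uop_lin (leqnn m).
have qU := Uop_quad (leqnn m).
(* A = U^(-1) satisfies A^2 = - b0 A + 1 *)
rewrite -[(e m)^-1]mul1r -[1 in RHS]invr1.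
apply: (@rank1_eig (heckeV b0 (Uop m)) _ _ (- b0) _ bn) => //.
- exact: klinear_heckeV.
- exact: Yop_lin.
- exact: heckeV_quad.
- exact: (Tn_quad H).
- by move=> f; rewrite Yop_Uop_pal // pal_m heckeKV.
- exact: oner_neq0.
- exact: e0.
- exact: eigE.
- by rewrite invr1 !mul1r hc; ring.
Qed.

(** The operator X_1 T_0^(-1). *)
Definition Aop f := X 0 (heckeV b0 S f).

Lemma Aop_Yop0 f : Aop (Yop 0 f) = Bop f.
Proof. by rewrite /Aop /= heckeKV //; apply: (S_quad H). Qed.

Lemma Bop_eig c : q != 0 -> c * (q^-1 * (e 0)^-1 - e 0) = ga * e 0 - q^-1 * al ->
  Yop 0 (Bop E + io c * E) = io (q^-1 * (e 0)^-1) * (Bop E + io c * E).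
Proof.
move=> q0 hc; apply: (rank1_eig _ _ (XS_quad H) Bop_quad Aop_Yop0 q0 _ _ hc).
- by move=> k f g; rewrite (klinear_heckeV _ (S_lin H)) (X_lin H).
- exact: Yop_lin.
- exact: e0.
- exact: eigE.
Qed.

Lemma Bop_eigE : Bop E = io (e 0) * Aop E.
Proof.
rewrite -Aop_Yop0 eigE // klinearZ //.
by move=> k f g; rewrite /Aop (klinear_heckeV _ (S_lin H)) (X_lin H).
Qed.

End AffineHecke.

(** * The operators T_i on a rational function field *)

Lemma dlop_klinear (K F : fieldType) (io : {rmorphism K -> F}) (s : {rmorphism F -> F}) c b :
  (forall k, s (io k) = io k) -> klinear io (dlop c b s).
Proof. by move=> sio k f g; rewrite !dlopE rmorphD rmorphM sio; ring. Qed.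

Lemma dlop_hecke_quad (K F : fieldType) (io : {rmorphism K -> F}) (s : {rmorphism F -> F}) c b :
  (forall f, s (s f) = f) -> (forall k, s (io k) = io k) -> c != 0 ->
  b + s b = io c + (io c)^-1 -> hecke_quad io (c - c^-1) (dlop (io c) b s).
Proof.
move=> ss sio c0 tr f; rewrite (dlop_quad ss) ?sio ?fmorph_eq0 //.
by rewrite rmorphB fmorphV.
Qed.

Lemma tperm_braid (T : finType) (a b c : T) : a != b -> b != c -> a != c -> forall j,
  tperm a b (tperm b c (tperm a b j)) = tperm b c (tperm a b (tperm b c j)).
Proof.
move=> ab bc ac j; have D x y z := @tpermD T x y z.
have [ba cb ca] : [/\ b != a, c != b & c != a] by rewrite !(eq_sym _ a) (eq_sym c).
have [->|ja] := eqVneq j a; first by rewrite (D b c a) // !tpermL (D a b c).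
have [->|jb] := eqVneq j b; first by rewrite tpermR tpermL (D b c a) // (D a b c) // tpermL tpermR.
have [->|jc] := eqVneq j c; first by rewrite (D a b c) // !tpermR (D b c a).
by rewrite !D // eq_sym.
Qed.

Lemma tperm_disjointC (T : finType) (a b c d : T) :
  a != c -> a != d -> b != c -> b != d -> forall j,
  tperm a b (tperm c d j) = tperm c d (tperm a b j).
Proof.
move=> ac ad bc bd j.
have [[ca da] [cb db]] : (c != a /\ d != a) /\ (c != b /\ d != b).
  by rewrite !(eq_sym _ a) !(eq_sym _ b).
case: (tpermP a b j) => [->|->|/eqP ja /eqP jb].
- by rewrite (tpermD ca da) tpermL (tpermD cb db).
- by rewrite (tpermD cb db) tpermR (tpermD ca da).
by case: (tpermP c d j) => *; rewrite tpermD // eq_sym.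
Qed.

Lemma lo_hi_neq m (i : 'I_m) : lo i != hi i.
Proof. by rewrite -val_eqE /= /bump /=; lia. Qed.

Record params_neq0 (K : fieldType) (pr : params K) : Prop := ParamsNeq0 {
  qh_neq0 : qh pr != 0; th_neq0 : th pr != 0; t0h_neq0 : t0h pr != 0;
  u0h_neq0 : u0h pr != 0; tnh_neq0 : tnh pr != 0; unh_neq0 : unh pr != 0 }.

(** A field generated, as far as automorphisms are concerned, by K and elements v j that
    behave like independent variables, together with the substitutions xi_0, xi_i, xi_n.
    Relations between the substitutions are then checked on the v j. *)
Record coordinates (K F : fieldType) (io : {rmorphism K -> F}) (q : K) m
    (v : 'I_m.+1 -> F) (r_first r_last : {rmorphism F -> F})
    (r_mid : 'I_m -> {rmorphism F -> F}) : Prop := Coordinates {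
  coord_inj : injective v;
  coordM_neq : forall i j c, v i * v j != io c;
  coord_ext : forall s r : {rmorphism F -> F},
    (forall c, s (io c) = io c) -> (forall c, r (io c) = io c) ->
    (forall j, s (v j) = r (v j)) -> s =1 r;
  r_first_cst : forall c, r_first (io c) = io c;
  r_mid_cst : forall i c, r_mid i (io c) = io c;
  r_last_cst : forall c, r_last (io c) = io c;
  r_first_var : forall j, r_first (v j) = if j == ord0 then io (q ^+ 2) / v ord0 else v j;
  r_mid_var : forall i j, r_mid i (v j) = v (tperm (lo i) (hi i) j);
  r_last_var : forall j, r_last (v j) = if j == ord_max then (v ord_max)^-1 else v j }.

Section HeckeRels.

Variables (K F : fieldType) (io : {rmorphism K -> F}) (pr : params K) (m : nat).
Variables (v : 'I_m.+1 -> F) (r_first r_last : {rmorphism F -> F}).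
Variables (r_mid : 'I_m -> {rmorphism F -> F}).
Hypothesis crd : coordinates io (qh pr) v r_first r_last r_mid.
Hypothesis p0 : params_neq0 pr.

Let hf := r_first_cst crd.
Let hm := r_mid_cst crd.
Let hl := r_last_cst crd.
Let vf := r_first_var crd.
Let vm := r_mid_var crd.
Let vl := r_last_var crd.

Let fixes_cst (s : F -> F) := forall c, s (io c) = io c.

Lemma coord_invol (s : {rmorphism F -> F}) : fixes_cst s ->
  (forall j, s (s (v j)) = v j) -> forall f, s (s f) = f.
Proof.
move=> hs e f; apply: (@coord_ext _ _ _ _ _ _ _ _ _ crd (s \o s) idfun) => //= c.
by rewrite !hs.
Qed.

Lemma coord_ext2 (s s' r r' : {rmorphism F -> F}) :
  fixes_cst s -> fixes_cst s' -> fixes_cst r -> fixes_cst r' ->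
  (forall j, s (s' (v j)) = r (r' (v j))) -> forall f, s (s' f) = r (r' f).
Proof.
move=> hs hs' hr hr' e f.
apply: (@coord_ext _ _ _ _ _ _ _ _ _ crd (s \o s') (r \o r')) => //= c.
  by rewrite hs' hs.
by rewrite hr' hr.
Qed.

Lemma coord_braid3 (s r : {rmorphism F -> F}) : fixes_cst s -> fixes_cst r ->
  (forall j, s (r (s (v j))) = r (s (r (v j)))) ->
  forall f, s (r (s f)) = r (s (r f)).
Proof.
move=> hs hr; apply: (@coord_ext2 s (r \o s) r (s \o r)) => // c /=.
  by rewrite hs hr.
by rewrite hr hs.
Qed.

Lemma coord_braid4 (s r : {rmorphism F -> F}) : fixes_cst s -> fixes_cst r ->
  (forall j, s (r (s (r (v j)))) = r (s (r (s (v j))))) ->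
  forall f, s (r (s (r f))) = r (s (r (s f))).
Proof.
move=> hs hr; apply: (@coord_ext2 (s \o r) (s \o r) (r \o s) (r \o s)) => c /=;
  by rewrite ?hr ?hs ?hr.
Qed.

Lemma coord_neq0 i : v i != 0.
Proof. by have := coordM_neq crd i i 0; rewrite rmorph0 mulf_eq0 orbb. Qed.

Definition Tmid i := dlop (io (th pr)) (bmid (io (th pr)) (v (lo i)) (v (hi i))) (r_mid i).
Definition Tlast := dlop (io (tnh pr)) (blast (io (tnh pr)) (io (unh pr)) (v ord_max)) r_last.
Definition Tfirst :=
  dlop (io (t0h pr)) (bfirst (io (qh pr)) (io (t0h pr)) (io (u0h pr)) (v ord0)) r_first.
Definition Tnat k : F -> F := if insub k is Some i then Tmid i else id.
Definition Xnat k (f : F) : F := v (inord k) * f.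

Lemma r_firstK f : r_first (r_first f) = f.
Proof.
have q0 : io (qh pr ^+ 2) != 0 by rewrite fmorph_eq0 expf_neq0 // qh_neq0.
have x0 := coord_neq0 ord0.
apply: (coord_invol hf) => j.
rewrite !vf; case: ifP => [/eqP->|jn]; last by rewrite vf jn.
by rewrite fmorph_div hf vf eqxx invf_div mulrCA divff // mulr1.
Qed.

Lemma r_midK i f : r_mid i (r_mid i f) = f.
Proof. by apply: (coord_invol (hm i)) => j; rewrite !vm tpermK. Qed.

Lemma r_lastK f : r_last (r_last f) = f.
Proof.
apply: (coord_invol hl) => j.
rewrite !vl; case: ifP => [/eqP->|jn]; last by rewrite vl jn.
by rewrite fmorphV vl eqxx invrK.
Qed.

Lemma TnatP k : (k < m)%N -> exists i : 'I_m, [/\ i = k :> nat, Tnat k = Tmid i,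
   inord k = lo i & inord k.+1 = hi i].
Proof.
move=> km; exists (Ordinal km); split=> //; first by rewrite /Tnat insubT.
  by apply/val_inj; rewrite /= inordK // ltnS ltnW.
by apply/val_inj; rewrite /= inordK.
Qed.

Lemma r_mid_mid_comm (i j : 'I_m) f : (i.+1 < j)%N -> r_mid i (r_mid j f) = r_mid j (r_mid i f).
Proof.
move=> ij; apply: (coord_ext2 (hm i) (hm j) (hm j) (hm i)) => k.
by rewrite !vm tperm_disjointC // -val_eqE /= /bump /=; lia.
Qed.

Lemma r_mid_braid (i j : 'I_m) f : i.+1 = j ->
  r_mid i (r_mid j (r_mid i f)) = r_mid j (r_mid i (r_mid j f)).
Proof.
move=> ij; apply: (coord_braid3 (hm i) (hm j)) => k.
have e : hi i = lo j by apply/val_inj; rewrite /= /bump /=; lia.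
by rewrite !vm e tperm_braid // -val_eqE /= /bump /=; lia.
Qed.

Lemma r_mid_last_comm (i : 'I_m) f : (i.+1 < m)%N -> r_mid i (r_last f) = r_last (r_mid i f).
Proof.
move=> im; apply: (coord_ext2 (hm i) hl hl (hm i)) => k.
have hn : hi i != ord_max by rewrite -val_eqE /= /bump /=; lia.
have ln : lo i != ord_max by rewrite -val_eqE /=; lia.
rewrite vm !vl; case: tpermP => [->|->|/eqP a /eqP b].
- by rewrite (negbTE hn) (negbTE ln) vm tpermL.
- by rewrite (negbTE hn) (negbTE ln) vm tpermR.
case: ifP => _; first by rewrite fmorphV vm tpermD.
by rewrite vm tpermD // eq_sym.
Qed.

Lemma r_mid_last_braid (i : 'I_m) f : i.+1 = m ->
  r_mid i (r_last (r_mid i (r_last f))) = r_last (r_mid i (r_last (r_mid i f))).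
Proof.
move=> im.
have hm' : hi i = ord_max by apply/val_inj; rewrite /= /bump /=; lia.
have ln : lo i != ord_max by rewrite -val_eqE /=; lia.
apply: (coord_braid4 (hm i) hl) => k.
have sl : r_mid i (v (lo i)) = v (hi i) by rewrite vm tpermL.
have sh : r_mid i (v (hi i)) = v (lo i) by rewrite vm tpermR.
have rl : r_last (v (lo i)) = v (lo i) by rewrite vl (negbTE ln).
have rh : r_last (v (hi i)) = (v (hi i))^-1 by rewrite vl hm' eqxx.
have [->|kh] := eqVneq k (hi i); first by rewrite !(fmorphV, sl, sh, rl, rh).
have [->|kl] := eqVneq k (lo i); first by rewrite !(fmorphV, sl, sh, rl, rh).
have sk : r_mid i (v k) = v k by rewrite vm tpermD // eq_sym.
have rk : r_last (v k) = v k by rewrite vl -hm' (negbTE kh).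
by rewrite !(sk, rk).
Qed.

Lemma r_first_mid_comm (i : 'I_m) f : (0 < i)%N -> r_first (r_mid i f) = r_mid i (r_first f).
Proof.
move=> i0; apply: (coord_ext2 hf (hm i) (hm i) hf) => k.
have hn : hi i != ord0 by rewrite -val_eqE /= /bump /=; lia.
have ln : lo i != ord0 by rewrite -val_eqE /=; lia.
rewrite vm !vf; case: tpermP => [->|->|/eqP a /eqP b].
- by rewrite (negbTE hn) (negbTE ln) vm tpermL.
- by rewrite (negbTE hn) (negbTE ln) vm tpermR.
case: ifP => _; first by rewrite fmorph_div hm vm tpermD.
by rewrite vm tpermD // eq_sym.
Qed.

Lemma r_first_last_comm f : (0 < m)%N -> r_first (r_last f) = r_last (r_first f).
Proof.
move=> m0; apply: (coord_ext2 hf hl hl hf) => k.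
have n0 : (ord_max == ord0 :> 'I_m.+1) = false by apply/negbTE; rewrite -val_eqE /=; lia.
have [e|kn] := eqVneq k ord_max.
  by rewrite e vf n0 !vl eqxx fmorphV vf n0.
rewrite vl (negbTE kn) vf; case: eqP => [_|_]; last by rewrite vl (negbTE kn).
by rewrite fmorph_div hl vl eq_sym n0.
Qed.

Lemma io_neq0 c : (io c != 0) = (c != 0).
Proof. by rewrite fmorph_eq0. Qed.

Let th0 : io (th pr) != 0. Proof. by rewrite io_neq0 th_neq0. Qed.
Let tnh0 : io (tnh pr) != 0. Proof. by rewrite io_neq0 tnh_neq0. Qed.
Let t0h0 : io (t0h pr) != 0. Proof. by rewrite io_neq0 t0h_neq0. Qed.
Let unh0 : io (unh pr) != 0. Proof. by rewrite io_neq0 unh_neq0. Qed.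
Let u0h0 : io (u0h pr) != 0. Proof. by rewrite io_neq0 u0h_neq0. Qed.
Let qh0 : io (qh pr) != 0. Proof. by rewrite io_neq0 qh_neq0. Qed.

Lemma v_eq i j : (v i == v j) = (i == j).
Proof. exact/inj_eq/(coord_inj crd). Qed.

Lemma v2_neq1 i : v i ^+ 2 != 1.
Proof. by have := coordM_neq crd i i 1; rewrite rmorph1. Qed.

Lemma Tmid_rels i :
  klinear io (Tmid i) /\ hecke_quad io (th pr - (th pr)^-1) (Tmid i).
Proof.
have lh := lo_hi_neq i; have mor := rmorph_bmid (hm i (th pr)).
split; first by apply: dlop_klinear.
apply: dlop_hecke_quad => //; [exact: r_midK | exact: th_neq0 |].
by rewrite mor !vm tpermL tpermR; apply: bmid_trace => //; rewrite v_eq.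
Qed.

Lemma Tlast_rels :
  klinear io Tlast /\ hecke_quad io (tnh pr - (tnh pr)^-1) Tlast.
Proof.
have mor := rmorph_blast (hl (tnh pr)) (hl (unh pr)).
split; first by apply: dlop_klinear.
apply: dlop_hecke_quad => //; [exact: r_lastK | exact: tnh_neq0 |].
rewrite mor vl eqxx; apply: blast_trace => //; first exact: v2_neq1.
exact: coord_neq0.
Qed.

Lemma Tfirst_rels :
  klinear io Tfirst /\ hecke_quad io (t0h pr - (t0h pr)^-1) Tfirst.
Proof.
split; first by apply: dlop_klinear.
apply: dlop_hecke_quad => //; [exact: r_firstK | exact: t0h_neq0 |].
rewrite /bfirst !(rmorphM, rmorphB, rmorphD, fmorphV, rmorphXn) !hf vf eqxx.
rewrite rmorphXn; apply: bfirst_trace => //; last exact: coord_neq0.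
by have := coordM_neq crd ord0 ord0 (qh pr ^+ 2); rewrite rmorphXn.
Qed.

Lemma Tmid_trivial_vars (i : 'I_m) j :
  j != lo i -> j != hi i -> r_mid i (v j) = v j.
Proof. by move=> jl jh; rewrite vm tpermD // eq_sym. Qed.

(** Each relation reduces to the corresponding identity for operators c - b (1 - s), once
    the reflections are known to satisfy it and to move the variables as they should. *)
Theorem coord_hecke_rels : hecke_rels io m Tnat Xnat Tfirst Tlast
  (th pr - (th pr)^-1) (t0h pr - (t0h pr)^-1) (tnh pr - (tnh pr)^-1)
  ((unh pr)^-1 - unh pr) ((u0h pr - (u0h pr)^-1) * qh pr) (qh pr ^+ 2).
Proof.
have bm i j := rmorph_bmid (hm i (th pr)) (v (lo j)) (v (hi j)).
have i0 : inord 0 = ord0 :> 'I_m.+1 by apply/val_inj; rewrite /= inordK.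
have im : inord m = ord_max :> 'I_m.+1 by apply/val_inj; rewrite /= inordK.
split.
- by move=> k /TnatP[i [_ -> _ _]]; have [] := Tmid_rels i.
- by move=> c f g; rewrite /Xnat; ring.
- by have [] := Tfirst_rels.
- by have [] := Tlast_rels.
- by move=> k /TnatP[i [_ -> _ _]]; have [] := Tmid_rels i.
- by have [] := Tfirst_rels.
- by have [] := Tlast_rels.
- move=> f /=; rewrite /Xnat im !rmorphB fmorphV.
  apply: mul_last_quad => //; first exact: r_lastK.
  + by rewrite vl eqxx.
  + exact: v2_neq1.
  + exact: coord_neq0.
- move=> f /=; rewrite /Xnat i0 /heckeV !(rmorphM, rmorphB, fmorphV, rmorphXn).
  apply: mul_first_quad => //; first exact: r_firstK.
  + by rewrite vf eqxx rmorphXn.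
  + by have := coordM_neq crd ord0 ord0 (qh pr ^+ 2); rewrite rmorphXn.
  + exact: coord_neq0.
- move=> k l /andP[kl lm] f.
  have [i [ik -> _ _]] := TnatP (ltn_trans (ltnW kl) lm).
  have [j [jl -> _ _]] := TnatP lm.
  apply: dlop_comm => //; first by move=> g; rewrite r_mid_mid_comm // ik jl.
    by rewrite bm !Tmid_trivial_vars // -val_eqE /= /bump /=; lia.
  by rewrite bm !Tmid_trivial_vars // -val_eqE /= /bump /=; lia.
- move=> k km f.
  have [i [ik -> e1 e2]] := TnatP (ltnW km).
  have [j [jk -> e3 e4]] := TnatP km.
  have e : hi i = lo j by rewrite -e2 e3.
  have [d1 d2 d3] : [/\ lo i != lo j, lo j != hi j & lo i != hi j].
    by rewrite -!val_eqE /= /bump /=; split; lia.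
  rewrite /Tmid e; apply: (@braid_mid _ _ _ _ _ _ (v (hi j))) => //;
    rewrite ?v_eq //; try exact: r_midK.
  + by move=> g; apply: r_mid_braid; rewrite ik jk.
  + by rewrite vm e tpermL.
  + by rewrite vm e tpermR.
  + by rewrite Tmid_trivial_vars // -?e eq_sym // e.
  + by rewrite Tmid_trivial_vars.
  + by rewrite vm tpermL.
  + by rewrite vm tpermR.
- move=> k km f.
  have [i [ik -> _ _]] := TnatP (ltnW km).
  have ki : (i.+1 < m)%N by rewrite ik.
  apply: dlop_comm => //; first by move=> g; rewrite r_mid_last_comm.
    rewrite (rmorph_blast (hm i _) (hm i _)) Tmid_trivial_vars // -val_eqE /= /bump /=; lia.
  by rewrite (rmorph_bmid (hl _)) !vl !ifN // -val_eqE /= /bump /=; lia.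
- move=> k km f.
  have [i [ik -> _ _]] := TnatP (eq_leq km).
  have hn : hi i = ord_max by apply/val_inj; rewrite /= /bump /=; lia.
  have ln : lo i != ord_max by rewrite -val_eqE /=; lia.
  rewrite /Tmid /Tlast hn; apply: braid_last => //; rewrite ?coord_neq0 ?v_eq ?v2_neq1 //.
  + exact: r_midK.
  + exact: r_lastK.
  + by move=> g; rewrite r_mid_last_braid // ik.
  + by rewrite vm hn tpermL.
  + by rewrite vm hn tpermR.
  + by rewrite vl (negbTE ln).
  + by rewrite vl eqxx.
  + by have := coordM_neq crd (lo i) ord_max 1; rewrite rmorph1.
- move=> k /andP[k0 km] f.
  have [i [ik -> _ _]] := TnatP km.
  apply: dlop_comm => //; first by move=> g; rewrite r_first_mid_comm // ik.
    by rewrite (rmorph_bmid (hf _)) !vf !ifN // -val_eqE /= /bump /=; lia.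
  rewrite /bfirst !(rmorphM, rmorphB, rmorphD, fmorphV, rmorphXn) !hm.
  by rewrite !Tmid_trivial_vars // -val_eqE /= /bump /=; lia.
- move=> m0 f; have n0 : ord_max != ord0 :> 'I_m.+1 by rewrite -val_eqE /=; lia.
  apply: dlop_comm => //; first by move=> g; rewrite r_first_last_comm.
    by rewrite (rmorph_blast (hf _) (hf _)) vf (negbTE n0).
  rewrite /bfirst !(rmorphM, rmorphB, rmorphD, fmorphV, rmorphXn) !hl.
  by rewrite vl eq_sym (negbTE n0).
- move=> k /andP[k0 km] f.
  have [i [ik -> _ _]] := TnatP km.
  rewrite /Xnat i0; apply: dlop_mul.
  by rewrite !Tmid_trivial_vars // -val_eqE /= /bump /=; lia.
- move=> m0 f; have n0 : ord_max != ord0 :> 'I_m.+1 by rewrite -val_eqE /=; lia.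
  by rewrite /Xnat i0; apply: dlop_mul; rewrite vl eq_sym (negbTE n0).
- move=> m0 f; rewrite /Xnat; symmetry; apply: dlop_mul.
  by rewrite vf ifN // -val_eqE /= inordK.
- move=> k km f; have [i [_ -> e1 e2]] := TnatP km.
  rewrite /Xnat e1 e2; apply: dlop_shift => //.
  + exact: r_midK.
  + by rewrite vm tpermL.
  + by rewrite vm tpermR.
  + by rewrite v_eq lo_hi_neq.
Qed.

End HeckeRels.

(** * Substitutions in the field of rational functions *)

Lemma fraction_numden (D : idomainType) (f : {fraction D}) :
  f = FracField.tofrac \n_(generic_quotient.repr f)
      / FracField.tofrac \d_(generic_quotient.repr f).
Proof.
apply: (canRL (mulfK _)); first by rewrite tofrac_eq0 denom_ratioP.
set n := \n_(_); set d := \d_(_).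
have d0 : d != 0 by apply: denom_ratioP.
rewrite -{1}[f]generic_quotient.reprK; unlock FracField.tofrac.
rewrite -[LHS]FracField.pi_mul; apply/generic_quotient.eqmodP.
rewrite /= /FracField.equivf /FracField.mulf !numden_Ratio ?mulr1 ?oner_eq0 //.
by rewrite mulrC.
Qed.

Section RationalFunctions.

Variables (K : fieldType) (m : nat).
Local Notation F := (ratfun K m).
Local Notation cst := (@cst K m).
Local Notation var := (@var K m).
Local Notation frac := (@FracField.tofrac {mpoly K[m.+1]}).
Implicit Types (f g : F) (p a b : {mpoly K[m.+1]}) (y : 'I_m.+1 -> F).

Fact cst_is_additive : zmod_morphism cst.
Proof. by move=> c d; rewrite /Defs.cst !rmorphB. Qed.
Fact cst_is_monoid : monoid_morphism cst.
Proof. by split=> [|c d]; rewrite /Defs.cst ?rmorph1 // !rmorphM. Qed.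
HB.instance Definition _ := GRing.isZmodMorphism.Build K F cst cst_is_additive.
HB.instance Definition _ := GRing.isMonoidMorphism.Build K F cst cst_is_monoid.

Lemma frac_numden f :
  f = frac \n_(generic_quotient.repr f) / frac \d_(generic_quotient.repr f).
Proof. exact: fraction_numden. Qed.

(** The condition under which [subst] extends to fractions: no nonzero denominator is
    sent to 0. *)
Definition subst_inj y := forall p, mmap cst y p = 0 -> p = 0.

(** The value of [subst] depends on the fraction only, and not on the representative
    that defines it. *)
Lemma subst_frac y a b : subst_inj y -> b != 0 ->
  subst y (frac a / frac b) = mmap cst y a / mmap cst y b.
Proof.
move=> inj b0; rewrite /subst; set f := _ / frac b.
have := frac_numden f; set n := \n_(_); set d := \d_(_).
have d0 : d != 0 by apply: denom_ratioP.
have nz p : p != 0 -> mmap cst y p != 0.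
  by apply: contra_neq; apply: inj.
move/eqP; rewrite eqr_div ?tofrac_eq0 // -!rmorphM tofrac_eq => /eqP e.
by apply/eqP; rewrite eqr_div ?nz // -!rmorphM -e mulrC.
Qed.

Section SubstMorphism.

Variables (y : 'I_m.+1 -> F) (inj : subst_inj y).

Let nz p : p != 0 -> mmap cst y p != 0.
Proof. by apply: contra_neq; apply: inj. Qed.

Fact subst_is_additive : zmod_morphism (subst y).
Proof.
move=> f g; rewrite (frac_numden f) (frac_numden g).
set n := \n_(_); set d := \d_(_); set n' := \n_(_); set d' := \d_(_).
have d0 : d != 0 by apply: denom_ratioP.
have d0' : d' != 0 by apply: denom_ratioP.
have -> : frac n / frac d - frac n' / frac d' = frac (n * d' - n' * d) / frac (d * d').
  by rewrite -mulNr addf_div ?tofrac_eq0 // mulNr !(rmorphM, rmorphB).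
rewrite !subst_frac ?mulf_neq0 // -[in RHS]mulNr addf_div ?nz //.
by rewrite mulNr !(rmorphM, rmorphB).
Qed.

Fact subst_is_monoid : monoid_morphism (subst y).
Proof.
split=> [|f g].
  have := @subst_frac y 1 1 inj (oner_neq0 _).
  by rewrite !rmorph1 !divr1.
rewrite (frac_numden f) (frac_numden g).
set n := \n_(_); set d := \d_(_); set n' := \n_(_); set d' := \d_(_).
have d0 : d != 0 by apply: denom_ratioP.
have d0' : d' != 0 by apply: denom_ratioP.
rewrite mulf_div -!rmorphM !subst_frac ?mulf_neq0 // mulf_div.
by rewrite !rmorphM.
Qed.

Definition subst_rmorphism : {rmorphism F -> F} :=
  HB.pack (subst y) (GRing.isZmodMorphism.Build F F (subst y) subst_is_additive)
   (GRing.isMonoidMorphism.Build F F (subst y) subst_is_monoid).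

Lemma subst_cst c : subst y (cst c) = cst c.
Proof.
have := @subst_frac y c%:MP 1 inj (oner_neq0 _).
by rewrite !rmorph1 !divr1 mmapC.
Qed.

Lemma subst_var j : subst y (var j) = y j.
Proof.
have := @subst_frac y 'X_j 1 inj (oner_neq0 _).
by rewrite !rmorph1 !divr1 mmapX mmap1U.
Qed.

End SubstMorphism.

Lemma rmorph_frac (s : {rmorphism F -> F}) p :
  (forall c, s (cst c) = cst c) -> s (frac p) = mmap cst (s \o var) p.
Proof.
move=> sc; rewrite {1}(mpolyE p) !rmorph_sum; apply: eq_bigr => k _.
rewrite -mul_mpolyC !rmorphM sc; congr (_ * _).
rewrite mpolyXE_id !rmorph_prod /mmap1; apply: eq_bigr => i _.
by rewrite !rmorphXn.
Qed.

Lemma rmorph_ratfun_ext (s r : {rmorphism F -> F}) :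
  (forall c, s (cst c) = cst c) -> (forall c, r (cst c) = cst c) ->
  (forall j, s (var j) = r (var j)) -> s =1 r.
Proof.
move=> sc rc sr f; rewrite (frac_numden f) !fmorph_div !rmorph_frac //.
have E p : mmap cst (s \o var) p = mmap cst (r \o var) p.
  apply: eq_bigr => k _; congr (_ * _); apply: eq_bigr => i _.
  by rewrite /= sr.
by rewrite !E.
Qed.

(** Multiplying by a high power of the inverted variables clears denominators, and the
    exponents of the monomials so obtained remain distinct: they are permuted by sg and
    reflected (k becomes N - k) where neg holds.  No cancellation can occur. *)
Lemma monomial_subst_inj (c : 'I_m.+1 -> K) (sg : {perm 'I_m.+1}) (neg : pred 'I_m.+1) y :
  (forall j, c j != 0) ->
  (forall j, y j = cst (c j) * (if neg j then (var (sg j))^-1 else var (sg j))) ->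
  subst_inj y.
Proof.
move=> c0 yE p p0; apply/eqP; apply: contraT => pn0.
pose N := msize p.
pose flip (k : 'X_{1..m.+1}) := [multinom
  (if neg ((sg^-1)%g i) then N - k ((sg^-1)%g i) else k ((sg^-1)%g i))%N | i < m.+1].
pose M := \prod_j (if neg j then var (sg j) ^+ N else 1).
pose d (k : 'X_{1..m.+1}) := \prod_j c j ^+ k j.
have var0 j : var j != 0 by rewrite tofrac_eq0 -msize_poly_eq0 msizeX mdeg1.
have kN k : k \in msupp p -> forall j, (k j <= N)%N.
  move=> kp j; apply: leq_trans (_ : mdeg k <= _)%N; last exact/ltnW/msize_mdeg_lt.
  by rewrite mdegE (bigD1 j) //= leq_addr.
have term k : k \in msupp p -> mmap1 y k * M = frac (d k *: 'X_[flip k]).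
  move=> kp; rewrite -mul_mpolyC rmorphM /= -[frac (d k)%:MP]/(cst (d k)).
  rewrite (mpolyXE _ sg) !rmorph_prod -!big_split.
  apply: eq_bigr => j _ /=; rewrite yE mnmE permK !rmorphXn exprMn -mulrA.
  congr (_ * _); case: ifP => _; last by rewrite mulr1.
  by rewrite -{1}(subnK (kN _ kp j)) exprD mulrCA -exprMn mulVf // expr1n mulr1.
pose P := \sum_(k <- msupp p) (p@_k * d k) *: 'X_[flip k] : {mpoly K[m.+1]}.
have P0 : P = 0.
  apply/eqP; rewrite -tofrac_eq0 rmorph_sum /=; apply/eqP.
  transitivity (mmap cst y p * M); last by rewrite p0 mul0r.
  rewrite mulr_suml; apply: eq_big_seq => k kp.
  by rewrite -mulrA term // -scalerA -mul_mpolyC rmorphM.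
have [k kp] : {k | k \in msupp p} by exists (mlead p); exact: mlead_supp.
have : P@_(flip k) = p@_k * d k.
  rewrite raddf_sum /= (bigD1_seq k) ?msupp_uniq //= mcoeffZ mcoeffX eqxx mulr1.
  rewrite big_seq_cond big1 ?addr0 // => l /andP[lp lk].
  rewrite mcoeffZ mcoeffX; case: eqP => [e|_]; last by rewrite mulr0.
  case/eqP: lk; apply/mnmP => j; move/mnmP/(_ (sg j)): e; rewrite !mnmE !permK.
  by case: ifP => // _; have := kN _ lp j; have := kN _ kp j; lia.
rewrite P0 mcoeff0 => /esym/eqP; rewrite mulf_eq0 -[p@_k == 0]negbK -mcoeff_msupp kp /=.
by rewrite prodf_seq_eq0 => /hasP[j _ /=]; rewrite expf_eq0 (negbTE (c0 j)) andbF.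
Qed.

End RationalFunctions.

(** * Signed permutations and the element v_mu *)

Section Words.

Variable m : nat.
Implicit Types (w : {perm spt m}) (s : seq (option 'I_m)) (k : option 'I_m) (mu : weight m).

Local Notation refl := (@simple_refl m).
Definition word s : {perm spt m} := (\prod_(a <- s) refl a)%g.

Definition refl_fun k (p : spt m) : spt m :=
  if k is Some i then (p.1, tperm (lo i) (hi i) p.2)
  else if p.2 == ord_max then (~~ p.1, p.2) else p.

Lemma simple_reflE k p : refl k p = refl_fun k p.
Proof.
case: p => b j; case: k => [i|] /=; rewrite /refl_fun /=.
  have pI c : injective (pair c : 'I_m.+1 -> spt m) by move=> ? ? [].
  rewrite permM; case: b.
    by rewrite [tperm (false, _) _ _]tpermD //= (inj_tperm _ _ _ (pI true)).
  by rewrite -(inj_tperm _ _ _ (pI false)) [tperm (true, _) _ _]tpermD.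
by rewrite !permE /= !xpair_eqE; case: b => /=; case: eqP => // ->.
Qed.

Lemma refl_invol k : (refl k * refl k = 1)%g.
Proof.
apply/permP => -[b j]; rewrite permM perm1 !simple_reflE /refl_fun.
case: k => [i|] /=; first by rewrite tpermK.
by case: (boolP (j == _)) => [h|/negbTE h] /=; rewrite h /= ?negbK.
Qed.

Lemma reflV k : ((refl k)^-1 = refl k)%g.
Proof. by apply/eqP; rewrite eq_invg_mul refl_invol. Qed.

Lemma refl_Wfin k : refl k \in Wfin m.
Proof. by apply/mem_gen/imset_f. Qed.

Lemma word_Wfin s : word s \in Wfin m.
Proof. by rewrite /word; apply: group_prod => k _; apply: refl_Wfin. Qed.

Lemma word_rcons s k : word (rcons s k) = (word s * refl k)%g.
Proof. by rewrite /word -cats1 big_cat big_seq1. Qed.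

Lemma has_wordP w n : reflect (exists2 s, size s = n & w = word s) (has_word w n).
Proof.
apply: (iffP existsP) => [[s /eqP ->]|[s sn ->]]; first by exists s => //; rewrite size_tuple.
by exists (Tuple (introT eqP sn)); rewrite eqxx.
Qed.

(** A path without repetition in the Cayley graph visits each element at most once. *)
Lemma short_word w : w \in Wfin m -> exists2 s, (size s < #|Wfin m|)%N & w = word s.
Proof.
move=> wW; pose e (x y : {perm spt m}) := [exists k, y == (x * refl k)%g].
have [s ws] : exists s, w = word s.
  have /gen_prodgP[n [c cA ->]] := wW.
  have /fin_all_exists[f fE] i : exists k, c i = refl k by have /imsetP[k _ ->] := cA i; exists k.
  exists [seq f i | i <- index_enum 'I_n].
  by rewrite /word big_map; apply: eq_bigr => i _.
have [p pp pw] : exists2 p, path e 1%g p & w = last 1%g p.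
  rewrite ws; elim/last_ind: s {ws} => [|s k [p pp ps]].
    by exists [::]; rewrite ?/word ?big_nil.
  exists (rcons p (word s * refl k)%g); rewrite ?rcons_path ?last_rcons ?word_rcons // pp -ps /=.
  by apply/existsP; exists k.
have [p' pp' [up' wp']] :
    exists2 p', path e 1%g p' & uniq (1%g :: p') /\ w = last 1%g p'.
  by case/shortenP: pp pw => p' pp' up' _ ->; exists p'.
have path_word : forall q, path e 1%g q -> exists2 s, size s = size q & last 1%g q = word s.
  elim/last_ind => [|q x IH]; first by exists [::]; rewrite ?/word ?big_nil.
  rewrite rcons_path last_rcons => /andP[/IH[s' ss ls] /existsP[k /eqP->]].
  by exists (rcons s' k); rewrite ?size_rcons ?ss // word_rcons ls.
have [s' ss' ls'] := path_word _ pp'.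
exists s'; last by rewrite wp'.
rewrite ss' -[(size p').+1]/(size (1%g :: p')) -(card_uniqP up').
apply/subset_leq_card/subsetP => x; rewrite inE => /predU1P[->|]; first exact: group1.
have pathW : forall q y, y \in Wfin m -> path e y q -> all (mem (Wfin m)) q.
  elim=> //= z q IH y yW /andP[/existsP[k /eqP ->] yq].
  by rewrite groupM ?refl_Wfin //=; apply: IH yq; rewrite groupM ?refl_Wfin.
exact/allP/(pathW _ 1%g).
Qed.

Definition neg (p : spt m) : spt m := (~~ p.1, p.2).
(** The rank of a point in the order 1 < .. < n < -n < .. < -1, for which the simple
    reflections exchange neighbours and the length counts inversions. *)
Definition pos (p : spt m) : nat := if p.1 then (m.*2.+1 - p.2)%N else p.2.

Lemma negK : involutive neg.
Proof. by case=> b j; rewrite /neg negbK. Qed.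

Lemma pos_neg p : pos (neg p) = (m.*2.+1 - pos p)%N.
Proof. by case: p => -[] j; rewrite /pos /= ?subKn //; have := ltn_ord j; lia. Qed.

Lemma pos_lt p : (pos p < m.*2.+2)%N.
Proof. by case: p => -[] j; rewrite /pos /=; have := ltn_ord j; lia. Qed.

Lemma pos_inj : injective pos.
Proof.
case=> b j [b' j']; rewrite /pos /= => e.
have [h h'] := (ltn_ord j, ltn_ord j').
have [bb jj] : b = b' /\ j = j' :> nat by move: e; case: b; case: b' => e; split=> //; lia.
by rewrite bb; congr pair; apply: val_inj.
Qed.

Lemma pos_surj r : (r < m.*2.+2)%N -> exists p, pos p = r.
Proof.
move=> rN; case: (ltnP m r) => rm.
  by exists (true, inord (m.*2.+1 - r)); rewrite /pos /= inordK; lia.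
by exists (false, inord r); rewrite /pos /= inordK.
Qed.

Lemma refl_neg k p : refl k (neg p) = neg (refl k p).
Proof.
by rewrite !simple_reflE /refl_fun; case: k => //=; case: ifP.
Qed.

Lemma Wfin_neg w p : w \in Wfin m -> w (neg p) = neg (w p).
Proof.
case/short_word => s _ ->; elim/last_ind: s p => [|s k IH] p.
  by rewrite /word big_nil !perm1.
by rewrite word_rcons !permM IH refl_neg.
Qed.

Lemma Wfin_negV w p : w \in Wfin m -> (w^-1)%g (neg p) = neg ((w^-1)%g p).
Proof. by move=> wW; apply: Wfin_neg; rewrite groupV. Qed.

(** For b = - a the transpositions of (a, b) and of (- a, - b) coincide, whence the case
    distinction. *)
Definition reflection (a b : spt m) : {perm spt m} :=
  if b == neg a then tperm a b else (tperm a b * tperm (neg a) (neg b))%g.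

Lemma reflectionJ a b w : w \in Wfin m ->
  (reflection a b ^ w = reflection (w a) (w b))%g.
Proof.
move=> wW; rewrite /reflection -!Wfin_neg // (inj_eq perm_inj).
by case: ifP => _; rewrite ?conjMg !tpermJ.
Qed.

Lemma reflection_neg a b : reflection (neg b) (neg a) = reflection a b.
Proof.
rewrite /reflection !negK (eq_sym (neg a)).
case: (eqVneq b (neg a)) => [->|ba]; first by rewrite negK tpermC.
have nn p : p != neg p by case: p => -[] j; rewrite /neg xpair_eqE.
apply/permP => p; rewrite !permM (tpermC (neg b)) (tpermC b).
by apply: tperm_disjointC; rewrite // eq_sym (can2_eq negK negK).
Qed.

Definition simple_lo k : spt m := if k is Some i then (false, lo i) else (false, ord_max).
Definition simple_hi k : spt m := if k is Some i then (false, hi i) else (true, ord_max).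

Lemma reflection_simple k : reflection (simple_lo k) (simple_hi k) = refl k.
Proof. by case: k => [i|]; rewrite /reflection /= ?eqxx. Qed.

Lemma refl_inversion k a b : (pos a < pos b)%N -> (pos (refl k b) < pos (refl k a))%N ->
  (a = simple_lo k /\ b = simple_hi k) \/ (a = neg (simple_hi k) /\ b = neg (simple_lo k)).
Proof.
case: a b => x i [y j]; rewrite !simple_reflE.
have H : forall p q p' q', pos p = pos q -> pos p' = pos q' -> p = q /\ p' = q'.
  by move=> p q p' q' /pos_inj -> /pos_inj ->.
case: k => [l|] /=.
  have tE i' : tperm (lo l) (hi l) i' =
      (if i' == l :> nat then l.+1 else if i' == l.+1 :> nat then l : nat else i') :> nat.
    case: tpermP => [->|->|/eqP + /eqP +]; rewrite -?val_eqE /= /bump /= ?eqxx //.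
      by case: eqP => //; lia.
    by do 2![case: eqP => //=]; lia.
  rewrite /pos /= !tE => ab ba.
  suff : (pos (x, i) = l /\ pos (y, j) = l.+1 \/
         pos (x, i) = m.*2.+1 - l.+1 /\ pos (y, j) = m.*2.+1 - l)%N.
    by case=> -[e1 e2]; [left|right]; apply: H; rewrite ?e1 ?e2 /pos //= /bump /=; lia.
  move: ab ba; rewrite /pos /=; have := ltn_ord i; have := ltn_ord j; have := ltn_ord l.
  by case: x; case: y => /=; do ?case: eqP; lia.
have vE (z : 'I_m.+1) : (z == ord_max) = (z == m :> nat) by [].
move=> ab ba.
suff : (pos (x, i) = m /\ pos (y, j) = m.+1)%N.
  by case=> e1 e2; left; apply: H; rewrite ?e1 ?e2 /pos //=; lia.
move: ab ba; rewrite /pos !vE /=; have := ltn_ord i; have := ltn_ord j.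
by case: x; case: y => /=; do ?case: eqP => /=; lia.
Qed.

(** The exchange condition.  Reading the word from its end, the pair (a, b) is inverted at
    some letter; just before, it is carried to the simple pair of that letter, so that
    the reflection in (a, b) amounts to deleting the letter. *)
Lemma exchange s a b : (pos a < pos b)%N ->
  (pos (((word s)^-1)%g b) < pos (((word s)^-1)%g a))%N ->
  exists2 s', (size s' < size s)%N & word s' = (word s * reflection a b)%g.
Proof.
elim/last_ind: s a b => [|s k IH] a b ab.
  by rewrite /word big_nil invg1 !perm1; lia.
rewrite word_rcons invMg !permM reflV => ba.
case: (ltngtP (pos (refl k a)) (pos (refl k b))) => [ab'|ba'|/pos_inj/perm_inj e]; last first.
- by rewrite e ltnn in ab.
- exists s; first by rewrite size_rcons.
  have -> : reflection a b = refl k; last by rewrite -mulgA refl_invol mulg1.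
  case: (refl_inversion ab ba') => -[-> ->]; first exact: reflection_simple.
  by rewrite reflection_neg reflection_simple.
have [s' ss ws] := IH _ _ ab' ba; exists (rcons s' k); first by rewrite !size_rcons.
by rewrite word_rcons ws -reflectionJ ?refl_Wfin // conjgE reflV -!mulgA refl_invol mulg1.
Qed.

(** The weight as an odd function on the signed points. *)
Definition wval mu (p : spt m) : int := if p.1 then - mu p.2 else mu p.2.

Lemma wval_neg mu p : wval mu (neg p) = - wval mu p.
Proof. by case: p => -[] j; rewrite /wval /= ?opprK. Qed.

Lemma wactE w mu p : w \in Wfin m -> wval (wact w mu) p = wval mu ((w^-1)%g p).
Proof.
move=> wW; case: p => -[] j; rewrite /wval /= ffunE //.
rewrite (_ : (true, j) = neg (false, j)) // Wfin_negV //=.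
by case: ((w^-1)%g _) => -[] j' /=; rewrite ?opprK.
Qed.

Definition simple_act k mu : weight m := if k is Some i then s_mid i mu else s_last mu.

Lemma simple_actE k mu p : wval (simple_act k mu) p = wval mu (refl k p).
Proof.
rewrite simple_reflE /refl_fun /wval; case: k => [i|] /=; first by rewrite ffunE.
by case: p => b j; rewrite ffunE /=; case: (j == ord_max); case: b; rewrite /= ?opprK.
Qed.

Lemma wval_inj mu nu : wval mu =1 wval nu -> mu = nu.
Proof. by move=> e; apply/ffunP => j; have := e (false, j). Qed.

Lemma wact_refl w k mu : w \in Wfin m -> wact (w * refl k)%g mu = simple_act k (wact w mu).
Proof.
move=> wW; apply: wval_inj => p.
by rewrite simple_actE !wactE ?groupM ?refl_Wfin // invMg permM reflV.
Qed.

(** The coefficients are positive and strictly decreasing, so that each simple reflection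
    that makes a weight more antidominant lowers this form. *)
Definition height mu : int := \sum_(j < m.+1) (m.+1 - j)%N%:Z * mu j.

Lemma height_mid i mu : height (s_mid i mu) = height mu - (mu (lo i) - mu (hi i)).
Proof.
rewrite /height; have lh : hi i != lo i by rewrite -val_eqE /= /bump /=; lia.
rewrite (bigD1 (lo i)) //= (bigD1 (hi i)) //= [X in _ = X - _](bigD1 (lo i)) //=.
rewrite [X in _ = _ + X - _](bigD1 (hi i)) //= !ffunE tpermL tpermR.
rewrite (eq_bigr (fun j : 'I_m.+1 => (m.+1 - j)%N%:Z * mu j)) => [|j /andP[jl jh]]; last first.
  by rewrite ffunE tpermD // eq_sym.
have -> : (m.+1 - lo i)%N%:Z = (m.+1 - hi i)%N%:Z + 1.
  by rewrite /= /bump /=; have := ltn_ord i; lia.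
move: (_%:Z) (mu _) (mu _) (\sum_(_ | _) _) => *; lia.
Qed.

Lemma height_last mu : height (s_last mu) = height mu - mu ord_max *+ 2.
Proof.
rewrite /height (bigD1 ord_max) //= [X in _ = X - _](bigD1 ord_max) //= !ffunE eqxx.
rewrite (eq_bigr (fun j : 'I_m.+1 => (m.+1 - j)%N%:Z * mu j)) => [|j jm]; last first.
  by rewrite ffunE (negbTE jm).
rewrite subSnn; move: (mu _) (\sum_(_ | _) _) => *; lia.
Qed.

Lemma monotone_ends mu : (forall i, mu (lo i) <= mu (hi i)) ->
  forall j, mu ord0 <= mu j <= mu ord_max.
Proof.
move=> inc.
have chain d (k : nat) : (k + d <= m)%N -> mu (inord k) <= mu (inord (k + d)).
  elim: d => [|d IH] kd; first by rewrite addn0.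
  have km : (k + d < m)%N by lia.
  apply: le_trans (IH (ltnW km)) _; have := inc (Ordinal km).
  have -> : lo (Ordinal km) = inord (k + d) by apply: val_inj; rewrite /= inordK //; lia.
  by have -> : hi (Ordinal km) = inord (k + d.+1)
    by apply: val_inj; rewrite /= /bump /= inordK; lia.
move=> j; have jm : (j <= m)%N by rewrite -ltnS.
have -> : ord0 = inord 0 :> 'I_m.+1 by apply: val_inj; rewrite /= inordK.
have -> : ord_max = inord m :> 'I_m.+1 by apply: val_inj; rewrite /= inordK.
have := chain j 0%N jm; have := chain (m - j)%N j.
by rewrite add0n subnKC // inord_val => /(_ (leqnn m)) -> ->.
Qed.

(** An element of the orbit with the smallest height is antidominant. *)
Lemma antidominant_ex mu : exists2 w, w \in Wfin m & antidominant (wact w mu).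
Proof.
have := @arg_minP _ int {perm spt m} 1%g (fun w => w \in Wfin m)
  (fun w => height (wact w mu)) (group1 _).
case=> w /= wW wmin; exists w => //; set la := wact w mu.
have step k : height la <= height (simple_act k la).
  by rewrite /la -wact_refl //; apply: wmin; rewrite groupM ?refl_Wfin.
have mid i : la (lo i) <= la (hi i).
  by have := step (Some i); rewrite /= height_mid; lia.
have last : la ord_max <= 0 by have := step None; rewrite /= height_last; lia.
apply/andP; split; apply/forallP => j //.
by have /andP[_ jm] := monotone_ends mid j; exact: le_trans jm last.
Qed.

(** What the choice in the definition of v_mu gives, since an antidominant weight exists
    in every orbit. *)
Lemma v_spec mu : [/\ v_ mu \in Wfin m, antidominant (wact (v_ mu) mu) &
  forall w, w \in Wfin m -> antidominant (wact w mu) -> (wlength (v_ mu) <= wlength w)%N].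
Proof.
rewrite /v_; case: pickP => [v /and3P[vW va /forallP vmin]|none] /=.
  by split=> // w wW wa; have /implyP/(_ wW)/implyP/(_ wa) := vmin w.
have [w0 w0W w0a] := antidominant_ex mu.
pose P w := (w \in Wfin m) && antidominant (wact w mu).
have Pw0 : P w0 by rewrite /P w0W.
case: (arg_minnP (@wlength m) Pw0) => w /andP[wW wa] wmin.
have := none w; rewrite wW wa /=; move/negbT; case/negP.
by apply/forallP => u; apply/implyP => uW; apply/implyP => ua; apply: wmin; rewrite /P uW.
Qed.

Lemma wlength_le s : (wlength (word s) <= size s)%N.
Proof.
rewrite leqNgt; apply/negP => sl.
have /(before_find 0) := sl.
have sW : (size s < #|Wfin m|)%N.
  by apply: (leq_trans sl); rewrite -[X in (_ <= X)%N](size_iota 0) find_size.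
rewrite nth_iota // add0n.
by have /has_wordP -> : exists2 s', size s' = size s & word s = word s' by exists s.
Qed.

Lemma reduced_word w : w \in Wfin m -> exists2 s, size s = wlength w & w = word s.
Proof.
move=> wW; apply/has_wordP.
have [s sW ws] := short_word wW.
have hs : has (has_word w) (iota 0 #|Wfin m|).
  by apply/hasP; exists (size s); [rewrite mem_iota | apply/has_wordP; exists s].
have := nth_find 0 hs; rewrite nth_iota ?add0n //.
by move: hs; rewrite has_find size_iota.
Qed.

(** The lexicographic order on (value of mu, position) as an order on integers: positions
    are smaller than the factor 2n. *)
Definition key mu p : int := (m.*2.+2)%:Z * wval mu p + (pos p)%:Z.

Lemma key_neg mu p : key mu (neg p) = (m.*2.+1)%:Z - key mu p.
Proof. by rewrite /key wval_neg pos_neg; have := pos_lt p; nia. Qed.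

Lemma key_lt mu p q : (key mu p < key mu q) =
  (wval mu p < wval mu q) || ((wval mu p == wval mu q) && (pos p < pos q)%N).
Proof.
by rewrite /key; have := pos_lt p; have := pos_lt q => hq hp; apply/idP/idP; nia.
Qed.

Definition sorts mu (w : {perm spt m}) :=
  forall p q, key mu p < key mu q -> (pos (w p) < pos (w q))%N.

(** If the two values differ, antidominance orders them.  If they agree, the simple
    reflection fixes v_mu mu, and were the positions inverted, [exchange] would give a
    shorter element. *)
Lemma v_sorts_simple mu k (u := (v_ mu)^-1%g) :
  key mu (u (simple_lo k)) < key mu (u (simple_hi k)).
Proof.
have [vW va vmin] := v_spec mu; rewrite key_lt -!wactE //; set la := wact _ mu.
have ll : wval la (simple_lo k) <= wval la (simple_hi k).
  move: va => /andP[/forallP neg0 /forallP inc]; case: k => [i|]; first exact: inc.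
  by rewrite /wval /=; have := neg0 ord_max; rewrite -/la; lia.
move: ll; rewrite le_eqVlt orbC => /orP[->//|le_]; rewrite le_ /= orbC; apply/orP; left.
rewrite ltnNge leq_eqVlt; apply/negP => /orP[/eqP/pos_inj/perm_inj|lt_].
  by case: k {le_} => [i|] // /(congr1 (fun p : spt m => val p.2)); rewrite /= /bump /=; lia.
have [s ss vs] := reduced_word vW.
have ab : (pos (simple_lo k) < pos (simple_hi k))%N.
  by case: k {le_ lt_} => [i|]; rewrite /pos /= /bump /=; lia.
have [] := @exchange s _ _ ab; first by rewrite -vs.
move=> s' s's ws'; have e : word s' = (v_ mu * refl k)%g by rewrite ws' reflection_simple vs.
have : (wlength (v_ mu) <= wlength (word s'))%N.
  apply: vmin; first exact: word_Wfin.
  rewrite e wact_refl // (_ : simple_act k _ = la) //; apply/ffunP => j.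
  case: k le_ {lt_ ab ws' e} => [i|] /eqP; rewrite /wval /= => le_; rewrite [LHS]ffunE.
    by case: tpermP => [->|->|].
  by case: eqP => // ->; exact/esym.
by have := wlength_le s'; lia.
Qed.

Lemma key_inj mu : injective (key mu).
Proof.
move=> p q e; have := key_lt mu p q; have := key_lt mu q p; rewrite e ltxx.
case: (ltgtP (wval mu p) (wval mu q)) => //= _.
by case: (ltngtP (pos p) (pos q)) => // /pos_inj.
Qed.

(** Neighbouring positions are the pairs of [v_sorts_simple] and their negatives. *)
Lemma v_sortsV mu p q (u := (v_ mu)^-1%g) :
  (pos p < pos q)%N -> key mu (u p) < key mu (u q).
Proof.
have [vW _ _] := v_spec mu.
have adj p' q' : pos q' = (pos p').+1 -> key mu (u p') < key mu (u q').
  move=> pq; have := pos_lt q'; have := v_sorts_simple mu; rewrite -/u => hk.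
  case: (ltngtP (pos p') m) => pm qN.
  - have -> : p' = simple_lo (Some (Ordinal pm)) by apply: pos_inj.
    have -> : q' = simple_hi (Some (Ordinal pm)) by apply: pos_inj; rewrite pq /pos /= /bump.
    exact: hk.
  - have im : (m.*2.+1 - pos q' < m)%N by lia.
    have [i iE] : exists i : 'I_m, i = (m.*2.+1 - pos q')%N :> nat by exists (Ordinal im).
    have -> : p' = neg (simple_hi (Some i)).
      apply: pos_inj; rewrite pos_neg.
      have -> : pos (simple_hi (Some i)) = i.+1 by [].
      lia.
    have -> : q' = neg (simple_lo (Some i)).
      apply: pos_inj; rewrite pos_neg.
      have -> : pos (simple_lo (Some i)) = i by [].
      lia.
    by rewrite !Wfin_negV // !key_neg ltrD2l ltrN2; exact: hk.
  have -> : p' = simple_lo None by apply: pos_inj.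
  have -> : q' = simple_hi None by apply: pos_inj; rewrite pq pm /pos /=; lia.
  exact: hk.
move/subnKC; move: (_ - _)%N => d; elim: d q => [|d IH] q e; first by apply: adj; lia.
have [q' q'E] : exists q', pos q' = ((pos p).+1 + d)%N.
  by apply: pos_surj; have := pos_lt q; lia.
by apply: lt_trans (IH q' _) (adj _ _ _); lia.
Qed.

Lemma v_sorts mu : sorts mu (v_ mu).
Proof.
move=> p q pq; rewrite ltnNge; apply/negP; rewrite leq_eqVlt.
case/orP=> [/eqP/pos_inj/perm_inj qp|/(@v_sortsV mu)]; first by rewrite qp ltxx in pq.
by rewrite !permK => /(lt_trans pq); rewrite ltxx.
Qed.

(** An increasing bijection of a finite chain lies above the identity; applied to its
    inverse too, it is the identity.  This is the uniqueness in [sorts_uniq]. *)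
Lemma monotone_perm_ge (g : {perm spt m}) :
  (forall p q, (pos p < pos q)%N -> (pos (g p) < pos (g q))%N) ->
  forall p, (pos p <= pos (g p))%N.
Proof.
move=> mg p; move: {-1}(pos p) (erefl (pos p)) => r; elim: r p => [//|r IH] p pr.
have [p' p'r] : exists p', pos p' = r by apply: pos_surj; have := pos_lt p; lia.
by have := IH _ p'r; have := mg p' p; rewrite p'r pr => /(_ (ltnSn r)); lia.
Qed.

Lemma sorts_uniq mu w w' : sorts mu w -> sorts mu w' -> w = w'.
Proof.
have mono u u' : sorts mu u -> sorts mu u' -> forall p q, (pos p < pos q)%N ->
    (pos ((u^-1 * u')%g p) < pos ((u^-1 * u')%g q))%N.
  move=> su su' p q pq; rewrite !permM; apply: su'.
  set a := _ p; set b := _ q.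
  have [pE qE] : p = u a /\ q = u b by rewrite !permKV.
  case: (ltgtP (key mu a) (key mu b)) => // [/su|/key_inj ab].
    by rewrite -pE -qE; lia.
  by move: pq; rewrite pE qE ab ltnn.
move=> sw sw'; apply/permP => p.
have h1 := monotone_perm_ge (mono _ _ sw sw') (w p).
have h2 := monotone_perm_ge (mono _ _ sw' sw) (w' p).
by apply: pos_inj; move: h1 h2; rewrite !permM !permK; lia.
Qed.

Lemma sorts_v mu w : sorts mu w -> v_ mu = w.
Proof. exact: sorts_uniq (@v_sorts mu). Qed.

Lemma v_weight0 : v_ (weight0 m) = 1%g.
Proof.
apply: sorts_v => p q; rewrite key_lt !perm1 /wval !ffunE oppr0 !if_same ltxx.
by case/andP.
Qed.

Lemma refl_lo k : refl k (simple_lo k) = simple_hi k.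
Proof. by rewrite simple_reflE; case: k => [i|] /=; rewrite ?tpermL ?eqxx. Qed.

(** The reflection disturbs only the order of its own pair and of the negative pair, and
    these are not ties. *)
Lemma v_simple k mu : wval mu (simple_lo k) != wval mu (simple_hi k) ->
  v_ (simple_act k mu) = (refl k * v_ mu)%g.
Proof.
move=> ne; apply: sorts_v => p q pq; rewrite !permM; apply: v_sorts; move: pq.
rewrite !key_lt !simple_actE => /orP[->//|/andP[/eqP e pq]].
rewrite e ltxx eqxx /= ltnNge leq_eqVlt; apply/negP.
case/orP=> [/eqP/pos_inj/perm_inj qp|qp]; first by rewrite qp ltnn in pq.
have hl : refl k (simple_hi k) = simple_lo k by rewrite -refl_lo -permM refl_invol perm1.
case/eqP: ne; case: (refl_inversion pq qp) e => -[-> ->]; rewrite ?refl_neg refl_lo hl //.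
by rewrite !wval_neg => /oppr_inj.
Qed.

(** When 1 and -1 are exchanged and mu_1 is replaced by 1 - mu_1, the keys of these two
    points move by one, crossing no other key. *)
Lemma v_first mu : mu ord0 <= 0 ->
  v_ (s_first mu) = (tperm (false, ord0) (true, ord0) * v_ mu)%g.
Proof.
move=> mu0; set r := tperm _ _.
have rE p : r p = if p.2 == ord0 then neg p else p.
  by case: p => b j; rewrite permE /= !xpair_eqE; case: b => /=; case: eqP => // ->.
(* the key of -1 drops just below the old key of 1, and that of 1 rises just above
   the old key of -1 *)
have keyf : key (s_first mu) (false, ord0) = key mu (true, ord0) + 1.
  by rewrite /key /wval /pos /= ffunE eqxx; lia.
have keyt : key (s_first mu) (true, ord0) = key mu (false, ord0) - 1.
  by rewrite /key /wval /pos /= ffunE eqxx; lia.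
have keyo (p : spt m) : p.2 != ord0 -> key (s_first mu) p = key mu p.
  by case: p => b j jn; rewrite /key /wval /= ffunE (negbTE jn).
have ft : key mu (false, ord0) < key mu (true, ord0).
  by rewrite key_lt /wval /pos /=; lia.
have rf : r (false, ord0) = (true, ord0) by rewrite rE.
have rt : r (true, ord0) = (false, ord0) by rewrite rE.
have cases (p : spt m) : [\/ p = (false, ord0), p = (true, ord0) | p.2 != ord0].
  by case: p => -[] j; case: (eqVneq j ord0) => [->|?];
    [constructor 2|constructor 3|constructor 1|constructor 3].
have ro (p : spt m) : p.2 != ord0 -> r p = p by move=> pn; rewrite rE (negbTE pn).
apply: sorts_v => p q pq; rewrite !permM; apply: v_sorts; move: pq.
have inj (p' q' : spt m) : p'.2 == ord0 -> q'.2 != ord0 -> key mu p' != key mu q'.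
  by move=> p0 qn; apply/eqP => /key_inj e; rewrite -e p0 in qn.
case: (cases p) => [->|->|pn]; case: (cases q) => [->|->|qn];
  rewrite ?rf ?rt ?(ro _ pn) ?(ro _ qn) ?keyf ?keyt ?(keyo _ pn) ?(keyo _ qn) //; try lia.
- by have := inj (false, ord0) q (eqxx _) qn; lia.
- by have := inj (true, ord0) p (eqxx _) pn; lia.
Qed.

Lemma spt_int_neg p : spt_int (neg p) = - spt_int p.
Proof. by case: p => -[] j; rewrite /spt_int /= ?opprK. Qed.

End Words.

Section Evaluations.

Variables (K : fieldType) (pr : params K) (m : nat).
Implicit Types mu : weight m.
Local Notation ev_Y := (@ev_Y K pr m).

Hypothesis q0 : qh pr != 0.
Hypothesis t0 : th pr != 0.
Hypothesis c0 : t0h pr * tnh pr != 0.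

Lemma ev_Y_mid i mu j : mu (lo i) != mu (hi i) ->
  ev_Y (s_mid i mu) j = ev_Y mu (tperm (lo i) (hi i) j).
Proof.
move=> ne; rewrite /Defs.ev_Y -[s_mid i mu]/(simple_act (Some i) mu) v_simple //.
rewrite permM simple_reflE /=.
by rewrite ffunE.
Qed.

Lemma ev_Y_last mu j : mu ord_max != 0 ->
  ev_Y (s_last mu) j = if j == ord_max then (ev_Y mu j)^-1 else ev_Y mu j.
Proof.
move=> ne; have [vW _ _] := v_spec mu.
rewrite /Defs.ev_Y -[s_last mu]/(simple_act None mu) v_simple; last by rewrite /wval /=; lia.
rewrite permM simple_reflE /= ffunE; case: ifP => // _.
rewrite -[(true, j)]/(neg (false, j)) Wfin_neg // spt_int_neg.
by rewrite sgzN !invfM !invr_expz.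
Qed.

Lemma ev_Y_first mu j : mu ord0 <= 0 ->
  ev_Y (s_first mu) j = if j == ord0 then (qh pr ^+ 2)^-1 * (ev_Y mu j)^-1 else ev_Y mu j.
Proof.
move=> mu0; have [vW _ _] := v_spec mu.
rewrite /Defs.ev_Y v_first // permM permE /= !xpair_eqE /= ffunE.
case: eqP => [->|_] //.
rewrite -[(true, ord0)]/(neg (false, ord0)) Wfin_neg // spt_int_neg sgzN.
move: (qh pr ^+ 2) (expf_neq0 2 q0) => Q Q0.
rewrite !invfM !invr_expz !mulrA; congr (_ * _ * _).
by rewrite opprK opprB expfzDr // mulrC.
Qed.

Lemma ev_Y_neq0 mu j : ev_Y mu j != 0.
Proof.
have tt : th pr ^+ 2 != 0 by rewrite expf_neq0.
apply: mulf_neq0; last by apply: expfz_neq0; rewrite mulf_neq0 // expf_neq0.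
by apply: mulf_neq0; apply: expfz_neq0 => //; rewrite expf_neq0.
Qed.

Lemma ev_Y_0 j : ev_Y (weight0 m) j = t0h pr * tnh pr * (th pr ^+ 2) ^+ (m - j).
Proof.
rewrite /Defs.ev_Y v_weight0 perm1 ffunE oppr0 expr0z mul1r /spt_int /= expr1z.
have tt : th pr ^+ 2 != 0 by rewrite expf_neq0.
rewrite mulrC -(mulrA (t0h pr * _)); congr (_ * _).
by rewrite -exprnN -exprB ?unitfE ?subSS.
Qed.

End Evaluations.

(** * The recursion and the eigenvectors of the Y_j *)

Section WeightInduction.

Variable m : nat.
Implicit Types mu : weight m.

Definition l1norm mu : nat := (\sum_j `|mu j|)%N.

Lemma l1norm_mid i mu : l1norm (s_mid i mu) = l1norm mu.
Proof.
rewrite /l1norm [RHS](reindex_inj (@perm_inj _ (tperm (lo i) (hi i)))) /=.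
by apply: eq_bigr => j _; rewrite ffunE.
Qed.

Lemma l1norm_last mu : l1norm (s_last mu) = l1norm mu.
Proof. by apply: eq_bigr => j _; rewrite ffunE; case: ifP; rewrite ?abszN. Qed.

Lemma l1norm_first mu : mu ord0 > 0 -> l1norm mu = (l1norm (s_first mu)).+1.
Proof.
move=> mu0; rewrite /l1norm (bigD1 ord0) //= [in RHS](bigD1 ord0) //= ffunE eqxx.
rewrite [in RHS](eq_bigr (fun j => `|mu j|%N)) => [|j /negbTE j0]; last by rewrite ffunE j0.
by move: (\sum_(_ | _) _)%N => n; lia.
Qed.

Lemma height_le mu : height mu <= (m.+1 * l1norm mu)%N%:Z.
Proof.
rewrite /height /l1norm big_distrr /= (big_morph Posz PoszD (erefl _)).
apply: ler_sum => j _; rewrite PoszM abszE.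
have c0 : (0 : int) <= (m.+1 - j)%N by [].
have cm : ((m.+1 - j)%N%:Z <= m.+1%:Z) by lia.
by apply: (le_trans (ler_wpM2l c0 (ler_norm _))); apply: ler_wpM2r.
Qed.

Lemma s_midK i mu : s_mid i (s_mid i mu) = mu.
Proof. by apply/ffunP => j; rewrite !ffunE tpermK. Qed.

Lemma s_lastK mu : s_last (s_last mu) = mu.
Proof. by apply/ffunP => j; rewrite !ffunE; case: (j == _); rewrite ?opprK. Qed.

Lemma s_firstK mu : s_first (s_first mu) = mu.
Proof. by apply/ffunP => j; rewrite !ffunE; case: (j == _) => //; rewrite opprB addrC subrK. Qed.

(** Every weight is reached from 0 along the recursion.  Backwards: s_0 lowers the l1 norm
    when mu_1 > 0; otherwise a step that makes mu more dominant keeps the norm and raises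
    the height, which the norm bounds; if there is none, then mu = 0. *)
Lemma weight_ind (P : weight m -> Prop) : P (weight0 m) ->
  (forall mu, mu ord0 <= 0 -> P mu -> P (s_first mu)) ->
  (forall i mu, mu (hi i) < mu (lo i) -> P mu -> P (s_mid i mu)) ->
  (forall mu, 0 < mu ord_max -> P mu -> P (s_last mu)) ->
  forall mu, P mu.
Proof.
move=> P0 Pf Pm Pl mu.
have [n] := ubnP (l1norm mu); elim: n mu => // n IHn mu mun.
have [d] := ubnP `|(m.+1 * l1norm mu)%N%:Z - height mu|%N.
elim: d mu mun => // d IHd mu mun mud.
have hle := height_le mu.
have [mu0|mu0] := ltrP 0 (mu ord0).
  rewrite -[mu]s_firstK; apply: Pf; first by rewrite ffunE eqxx; lia.
  by apply: IHn; have := l1norm_first mu0; lia.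
have [/forallP inc|] := boolP [forall i, mu (hi i) <= mu (lo i)]; last first.
  rewrite negb_forall => /existsP[k]; rewrite -ltNge => kk.
  rewrite -[mu](s_midK k); apply: Pm; first by rewrite !ffunE tpermL tpermR.
  have hle' := height_le (s_mid k mu).
  apply: IHd; rewrite l1norm_mid // in hle' *.
  by rewrite height_mid in hle' *; lia.
have [mul|mul] := ltrP (mu ord_max) 0.
  rewrite -[mu]s_lastK; apply: Pl; first by rewrite ffunE eqxx; lia.
  have hle' := height_le (s_last mu).
  apply: IHd; rewrite l1norm_last // in hle' *.
  by rewrite height_last in hle' *; lia.
suff -> : mu = weight0 m by [].
pose nu : weight m := [ffun j => - mu j].
have inc' i : nu (lo i) <= nu (hi i) by rewrite !ffunE lerN2.
apply/ffunP => j; have /andP[] := monotone_ends inc' j; rewrite !ffunE.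
by move: (mu _) (mu _) (mu _) mu0 mul => a b c; lia.
Qed.

End WeightInduction.

Section Eigenvectors.

Variables (K F : fieldType) (io : {rmorphism K -> F}) (pr : params K) (m : nat).
Variables (v : 'I_m.+1 -> F) (r_first r_last : {rmorphism F -> F}).
Variables (r_mid : 'I_m -> {rmorphism F -> F}).
Hypothesis crd : coordinates io (qh pr) v r_first r_last r_mid.
Hypothesis p0 : params_neq0 pr.

Local Notation T := (Tnat io pr v r_mid).
Local Notation X := (Xnat v).
Local Notation Tn := (Tlast io pr v r_last).
Local Notation S := (Tfirst io pr v r_first).
Local Notation b := (th pr - (th pr)^-1).
Local Notation BX := (Bop m T X Tn).
Local Notation YX := (Yop io m T S Tn b).
Local Notation e := (ev_Y pr).

Let H := coord_hecke_rels crd p0.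

Lemma Tnat_1 k : (k < m)%N -> T k 1 = io (th pr) * 1.
Proof.
by move=> km; have [i [_ -> _ _]] := TnatP io pr v r_mid km; rewrite /Tmid dlop1 mulr1.
Qed.

Lemma pal_1 k : (k <= m)%N -> pal m T Tn k 1 = io (tnh pr * (th pr ^+ 2) ^+ (m - k)) * 1.
Proof.
move: k; apply: down_ind => [|k km IH].
  by rewrite pal_m subnn expr0 !mulr1 /Tlast dlop1.
rewrite palE // Tnat_1 // (klinearZ _ _ (pal_lin H km)) IH mulrA -rmorphM.
rewrite (klinearZ _ _ (T_lin H km)) Tnat_1 // !mulrA -!rmorphM; congr (io _ * _).
by rewrite -(subnSK km) [in RHS](exprS _ (m - k.+1)); ring.
Qed.

(** Each T_i multiplies 1 by a constant. *)
Lemma Yop_1 j : (j <= m)%N -> YX j 1 = io (t0h pr * tnh pr * (th pr ^+ 2) ^+ (m - j)) * 1.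
Proof.
have th0 := th_neq0 p0.
elim: j => [_|j IH jm] /=.
  rewrite pal_1 // (klinearZ _ _ (S_lin H)) /Tfirst dlop1 subn0 mulr1 -rmorphM; congr (io _).
  by ring.
have Ti1 : Ti io T b j 1 = io (th pr)^-1 * 1.
  by rewrite /Ti /heckeV Tnat_1 // rmorphB; ring.
have lT : klinear io (Ti io T b j) := klinear_heckeV b (T_lin H jm).
rewrite Ti1 (klinearZ _ _ (Yop_lin H (ltnW jm))) IH ?(ltnW jm) // mulrA -rmorphM.
rewrite (klinearZ _ _ lT) Ti1 !mulrA -!rmorphM; congr (io _ * _).
by rewrite -(subnSK jm) (exprS _ (m - j.+1)); field.
Qed.

(** The recursion of \hat E, with the scalars ev_mu(F) left free. *)
Record Ehat_rec (c_first c_last : weight m -> K) (c_mid : 'I_m -> weight m -> K)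
    (E : weight m -> F) : Prop := EhatRec {
  Er_0 : E (weight0 m) = 1;
  Er_first : forall mu : weight m, mu ord0 <= 0 ->
    E (s_first mu) = BX (E mu) + io (c_first mu) * E mu;
  Er_mid : forall i (mu : weight m), mu (lo i) > mu (hi i) ->
    E (s_mid i mu) = T i (E mu) + io (c_mid i mu) * E mu;
  Er_last : forall mu : weight m, mu ord_max > 0 ->
    E (s_last mu) = Tn (E mu) + io (c_last mu) * E mu }.

Variables (c_first c_last : weight m -> K) (c_mid : 'I_m -> weight m -> K).
Variable E : weight m -> F.
Hypothesis Er : Ehat_rec c_first c_last c_mid E.
Hypothesis c_firstE : forall mu : weight m, mu ord0 <= 0 ->
  c_first mu * ((qh pr ^+ 2)^-1 * (e mu ord0)^-1 - e mu ord0)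
  = ((unh pr)^-1 - unh pr) * e mu ord0 - (qh pr ^+ 2)^-1 * ((u0h pr - (u0h pr)^-1) * qh pr).
Hypothesis c_midE : forall i (mu : weight m), mu (lo i) > mu (hi i) ->
  c_mid i mu * (e mu (lo i) - e mu (hi i)) = - b * e mu (lo i).
Hypothesis c_lastE : forall mu : weight m, mu ord_max > 0 ->
  c_last mu * ((e mu ord_max)^-1 - e mu ord_max)
  = (t0h pr - (t0h pr)^-1) + (tnh pr - (tnh pr)^-1) * e mu ord_max.

Theorem Yop_eigenvector mu j : (j <= m)%N -> YX j (E mu) = io (e mu (inord j)) * E mu.
Proof.
have t0 := th_neq0 p0; have q0 := qh_neq0 p0.
have cc : t0h pr * tnh pr != 0 by rewrite mulf_neq0 ?t0h_neq0 ?tnh_neq0.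
have en0 nu i : e nu i != 0 by apply: ev_Y_neq0.
have Q0 : qh pr ^+ 2 != 0 by rewrite expf_neq0.
move: mu j; apply: weight_ind.
- move=> j jm; rewrite (Er_0 Er) Yop_1 // ev_Y_0 //; congr (io (_ * _ ^+ _) * _).
  by rewrite inordK.
- move=> mu mu0 IH j jm; rewrite (Er_first Er) // ev_Y_first //.
  have [->|j0] := posnP j.
    have i0 : inord 0 = ord0 :> 'I_m.+1 by apply/val_inj; rewrite /= inordK.
    rewrite i0 eqxx; have := Bop_eig H IH _ Q0; rewrite i0.
    by apply=> //; exact: c_firstE.
  rewrite ifN; last by rewrite -val_eqE /= inordK // -lt0n.
  by apply: (comm_eig H IH) => //; [exact: (Bop_lin H) | apply: (Bop_Yop_comm H); rewrite j0].
- move=> i mu mui IH j jm; rewrite (Er_mid Er) // ev_Y_mid; last by rewrite gt_eqF.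
  have elo : inord i = lo i by apply/val_inj => /=; rewrite inordK // ltnS; apply: ltnW.
  have ehi : inord i.+1 = hi i by apply/val_inj => /=; rewrite inordK // ltnS.
  have hc : c_mid i mu * (e mu (inord i) - e mu (inord i.+1)) = - b * e mu (inord i).
    by rewrite elo ehi; apply: c_midE.
  have [->|ji] := eqVneq j i.
    by rewrite (T_eig_lo H IH) // elo tpermL ehi.
  have [->|ji1] := eqVneq j i.+1.
    by rewrite (T_eig_hi H IH) // ehi tpermR elo.
  have -> : tperm (lo i) (hi i) (inord j) = inord j.
    by rewrite tpermD // -val_eqE /= inordK // eq_sym.
  by apply: (comm_eig H IH) => //; [exact: (T_lin H) | exact: (T_Yop_comm H)].
move=> mu mun IH j jm; have ne : mu ord_max != 0 by rewrite gt_eqF.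
rewrite (Er_last Er) // ev_Y_last //.
have im : inord m = ord_max :> 'I_m.+1 by apply/val_inj; rewrite /= inordK.
have [->|jn] := eqVneq j m.
  rewrite im eqxx -im; apply: (Tn_eig H IH) => //.
  by rewrite im; apply: c_lastE.
rewrite ifN; last by rewrite -val_eqE /= inordK.
apply: (comm_eig H IH) => //; first exact: (Tn_lin H).
by apply: (Tn_Yop_comm H); lia.
Qed.

Theorem Bop_eigenvector mu : BX (E mu) =
  io (e mu ord0) * (v ord0 * heckeV io (t0h pr - (t0h pr)^-1) S (E mu)).
Proof.
have i0 : inord 0 = ord0 :> 'I_m.+1 by apply/val_inj; rewrite /= inordK.
have := Bop_eigE H (@Yop_eigenvector mu); rewrite /Aop /Xnat i0; apply.
Qed.

End Eigenvectors.

(** * Evaluation of rational functions at generic parameters *)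

Section Values.

Variables (K : fieldType) (m : nat) (y : 'I_m.+1 -> K).
Local Notation F := (ratfun K m).
Local Notation frac := (@FracField.tofrac {mpoly K[m.+1]}).
Implicit Types (f g : F) (c d : K).

(** The rational function f is regular at y with value c.  In contrast with [value_at],
    this is compatible with the field operations by construction. *)
Definition evals f c := exists a b : {mpoly K[m.+1]},
  [/\ b.@[y] != 0, f = frac a / frac b & c = a.@[y] / b.@[y]].

Lemma meval_neq0 (b : {mpoly K[m.+1]}) : b.@[y] != 0 -> frac b != 0.
Proof. by apply: contra_neq => /eqP; rewrite tofrac_eq0 => /eqP ->; rewrite meval0. Qed.

Lemma evals_uniq f c d : evals f c -> evals f d -> c = d.
Proof.
move=> [a [b [b0 -> ->]]] [a' [b' [b0' e ->]]].
have /eqP := e; rewrite eqr_div ?meval_neq0 // -!rmorphM tofrac_eq => /eqP e'.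
by apply/eqP; rewrite eqr_div // -!mevalM e'.
Qed.

Lemma value_atE f c : evals f c -> value_at y f = c.
Proof.
move=> fc; apply: (evals_uniq _ fc); rewrite /value_at.
exact: (ClassicalEpsilon.epsilon_spec (inhabits 0) (evals f) (ex_intro _ c fc)).
Qed.

Lemma evals_cst c : evals (cst m c) c.
Proof.
exists c%:MP, 1; rewrite meval1 mevalC rmorph1 !divr1; split=> //.
exact: oner_neq0.
Qed.

Lemma evals_var j : evals (var K j) (y j).
Proof.
exists 'X_j, 1; rewrite meval1 mevalXU rmorph1 !divr1; split=> //.
exact: oner_neq0.
Qed.

Lemma evalsD f g c d : evals f c -> evals g d -> evals (f + g) (c + d).
Proof.
move=> [a [b [b0 -> ->]]] [a' [b' [b0' -> ->]]].
exists (a * b' + a' * b), (b * b'); rewrite !mevalM mevalD !mevalM mulf_neq0 //.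
by split=> //; rewrite addf_div ?meval_neq0 // ?rmorphD ?rmorphM.
Qed.

Lemma evalsM f g c d : evals f c -> evals g d -> evals (f * g) (c * d).
Proof.
move=> [a [b [b0 -> ->]]] [a' [b' [b0' -> ->]]].
exists (a * a'), (b * b'); rewrite !mevalM mulf_neq0 //.
by split=> //; rewrite mulf_div ?rmorphM.
Qed.

Lemma evals1 : evals 1 1.
Proof. by have := evals_cst 1; rewrite /cst !rmorph1. Qed.

Lemma evalsN f c : evals f c -> evals (- f) (- c).
Proof.
by have := evals_cst (-1) => /evalsM h /h; rewrite /cst !rmorphN1 !mulN1r.
Qed.

Lemma evalsB f g c d : evals f c -> evals g d -> evals (f - g) (c - d).
Proof. by move=> hf /evalsN; apply: evalsD. Qed.

Lemma evalsV f c : c != 0 -> evals f c -> evals f^-1 c^-1.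
Proof.
move=> c0 [a [b [b0 -> cE]]]; exists b, a; rewrite cE !invf_div; split=> //.
by move: c0; rewrite cE mulf_eq0 negb_or => /andP[].
Qed.

Lemma evals_div f g c d : d != 0 -> evals f c -> evals g d -> evals (f / g) (c / d).
Proof. by move=> d0 hf /(evalsV d0); apply: evalsM. Qed.

Lemma evalsX f c n : evals f c -> evals (f ^+ n) (c ^+ n).
Proof.
move=> fc; elim: n => [|n IH]; first by rewrite !expr0; exact: evals1.
by rewrite !exprS; apply: evalsM.
Qed.

Lemma evals_exprz f c (n : int) : c != 0 -> evals f c -> evals (f ^ n) (c ^ n).
Proof.
move=> c0 fc; case: n => n; first exact: evalsX.
by rewrite !NegzE -!invr_expz; apply: evalsV; [rewrite expfz_neq0 | apply: evalsX].
Qed.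

End Values.

Lemma expz_ratio (L : fieldType) (Q g g' : L) (k l : int) : Q != 0 -> g != 0 ->
  Q ^ (- k) * g = Q ^ (- l) * g' -> Q ^ (k - l) * (g' * g^-1) = 1.
Proof.
move=> Q0 g0 E; rewrite expfzDr // mulrA -[_ * _ * g']mulrA -E mulrA -expfzDr //.
by rewrite addrN mul1r mulfV.
Qed.

Lemma expz_sqr (L : fieldType) (Q g : L) (k : int) : Q != 0 ->
  Q * (Q ^ k * g) ^+ 2 = Q ^ (1 + k * 2) * g ^+ 2.
Proof. by move=> Q0; rewrite exprMn mulrA (exprnP (_ ^ _)) exprz_exp expfzDr. Qed.

Section GenericParameters.

Variable R : realType.
Local Notation K := (genK R).
Local Notation pr := (gen_params R).
Let pt (i : 'I_6) : R[i] := if i == inord 0 then 0 else 1.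

(** Elements that are regular and nonzero at the point where q^(1/2) = 0 and the other
    parameters are 1.  A nonzero power of q times such an element is 0 or infinite
    there, hence is not 1. *)
Definition qfree (z : K) := exists2 c, c != 0 & @evals R[i] 5 pt z c.

Lemma qfreeM z w : qfree z -> qfree w -> qfree (z * w).
Proof. by move=> [c c0 hc] [d d0 hd]; exists (c * d); [rewrite mulf_neq0 | apply: evalsM]. Qed.

Lemma qfree_exprz z (n : int) : qfree z -> qfree (z ^ n).
Proof. by move=> [c c0 hc]; exists (c ^ n); [rewrite expfz_neq0 | apply: evals_exprz]. Qed.

Lemma qfreeV z : qfree z -> qfree z^-1.
Proof. by move=> [c c0 hc]; exists c^-1; [rewrite invr_eq0 | apply: evalsV]. Qed.

Lemma qfree_gen (k : nat) : (0 < k < 6)%N -> qfree (gen R k).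
Proof.
move=> /andP[k0 k6]; exists 1; first exact: oner_neq0.
have := @evals_var R[i] 5 pt (inord k); rewrite /pt ifN //.
by rewrite -val_eqE /= !inordK // -lt0n.
Qed.

Lemma gen_neq0 k : gen R k != 0.
Proof. by rewrite tofrac_eq0 -msize_poly_eq0 msizeX mdeg1. Qed.

Lemma gen_params_neq0 : params_neq0 pr.
Proof. by split; apply: gen_neq0. Qed.

Lemma qfree_neq z (k : nat) : qfree z -> qh pr ^+ k.+1 * z != 1.
Proof.
move=> [c c0 hc]; apply/eqP => e.
have h0 : @evals R[i] 5 pt (qh pr) 0.
  by have := @evals_var R[i] 5 pt (inord 0); rewrite /pt eqxx.
have := evals_uniq (evalsM (evalsX k.+1 h0) hc) (_ : evals pt _ 1).
rewrite e expr0n mul0r => /(_ (evals1 _)) /eqP.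
by rewrite eq_sym oner_eq0.
Qed.

Lemma qfree_neqz z (k : int) : k != 0 -> qfree z -> qh pr ^ k * z != 1.
Proof.
case: k => [[|k]|k] // _ hz; first exact: qfree_neq.
rewrite NegzE -exprnN.
have := qfree_neq k (qfreeV hz); apply: contra_neq => e.
have q0 : qh pr ^+ k.+1 != 0 by rewrite expf_neq0 // gen_neq0.
have z0 : z != 0 by apply: contra_eq_neq e => ->; rewrite mulr0 eq_sym oner_neq0.
by rewrite -[z]invrK -invfM in e; rewrite -[LHS]invrK e invr1.
Qed.

Variable m : nat.
Implicit Types mu : weight m.
Local Notation e := (ev_Y pr).

Lemma ev_Y_qfree mu j : exists2 g, qfree g & e mu j = (qh pr ^+ 2) ^ (- mu j) * g.
Proof.
rewrite /ev_Y -mulrA; eexists; last reflexivity.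
apply: qfreeM; apply: qfree_exprz.
  by rewrite expr2; apply: qfreeM; apply: qfree_gen.
apply: qfreeM; first by apply: qfreeM; apply: qfree_gen.
by rewrite exprnP; apply: qfree_exprz; rewrite expr2; apply: qfreeM; apply: qfree_gen.
Qed.

Let Q0 : qh pr ^+ 2 != 0. Proof. by rewrite expf_neq0 // gen_neq0. Qed.

Lemma qfree_neq2 z (k : int) : k != 0 -> qfree z -> (qh pr ^+ 2) ^ k * z != 1.
Proof.
by move=> k0 hz; rewrite (exprnP (qh pr) 2) exprz_exp; apply: qfree_neqz => //; lia.
Qed.

Lemma ev_Y_mid_neq mu i : mu (lo i) != mu (hi i) -> e mu (lo i) != e mu (hi i).
Proof.
move=> ne; have [g hg lE] := ev_Y_qfree mu (lo i).
have [g' hg' hE] := ev_Y_qfree mu (hi i).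
have g0 : g != 0.
  have h : e mu (lo i) != 0.
    by apply: ev_Y_neq0; rewrite ?mulf_neq0 ?gen_neq0.
  by apply: contra_neq h => g0; rewrite lE g0 mulr0.
have kne : mu (lo i) - mu (hi i) != 0 by rewrite subr_eq0.
apply: contra_neq (qfree_neq2 kne (qfreeM hg' (qfreeV hg))) => E.
by rewrite lE hE in E; exact: expz_ratio Q0 g0 E.
Qed.

Lemma ev_Y_last_neq mu : mu ord_max != 0 -> e mu ord_max ^+ 2 != 1.
Proof.
move=> ne; have [g hg ->] := ev_Y_qfree mu ord_max.
rewrite exprMn (exprnP (_ ^ _)) exprz_exp; apply: qfree_neq2; first by lia.
by rewrite expr2; apply: qfreeM.
Qed.

Lemma ev_Y_first_neq mu : qh pr ^+ 2 * e mu ord0 ^+ 2 != 1.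
Proof.
have [g hg ->] := ev_Y_qfree mu ord0.
rewrite (expz_sqr _ _ Q0); apply: qfree_neq2; first by lia.
by rewrite expr2; apply: qfreeM.
Qed.

End GenericParameters.

(** * The recursion formulas *)

Section Identities.

Variable F : fieldType.
Implicit Types (x y f g t u s q e D Fp : F).

Lemma mid_expand t x y f D Fp ti tt C : t != 0 -> ti = t^-1 -> tt = t ^+ 2 -> C = Fp + t ->
  ti * (tt * f - (y - tt * x) * D) + Fp * f = C * f - (ti * y - t * x) * D.
Proof. by move=> t0 -> -> ->; field. Qed.

Lemma last_expand t x f D Fp ti tt C p w : t != 0 -> ti = t^-1 -> tt = t ^+ 2 ->
  C = Fp + t ->
  ti * (tt * f - (1 + w * x) * (1 - p * x) * D) + Fp * f
  = C * f - ti * (1 - p * x) * (1 + w * x) * D.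
Proof. by move=> t0 -> -> ->; field. Qed.

Lemma first_expand q t u x f g e Fm ti uq tq qq : t != 0 -> u != 0 ->
  ti = t^-1 -> uq = (u^-1 - u) * q -> tq = t * q ^+ 2 -> qq = q ^+ 2 ->
  e * (x * (dlop t (bfirst q t u x) (fun=> g) f - (t - t^-1) * f)) + Fm * f
  = Fm * f + ti * e * x * f - e * (ti * x ^+ 3 + uq * x ^+ 2 - tq * x)
    * ((x ^+ 2 - qq)^-1 * (f - g)).
Proof.
move=> t0 u0 -> -> -> ->; rewrite /dlop /bfirst; move: (x ^+ 2 - q ^+ 2)^-1 => w.
by field; rewrite t0 u0.
Qed.

Lemma C_mid_scalar t e (e' : F) : t != 0 -> 1 - e^-1 * e' != 0 ->
  t^-1 * ((1 - t ^+ 2 * e^-1 * e') / (1 - e^-1 * e'))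
  = t^-1 * ((1 - t ^+ 2) / (1 - e^-1 * e')) + t.
Proof. by move: e^-1 => w t0 d0; field; rewrite t0 d0. Qed.

Lemma C_last_scalar t s e : t != 0 -> s != 0 -> 1 - e ^- 2 != 0 ->
  t^-1 * ((1 - s * t * e^-1) * (1 + t / s * e^-1) / (1 - e ^- 2))
  = ((t^-1 - t) + (s^-1 - s) * e^-1) / (1 - e ^- 2) + t.
Proof. by rewrite -exprVn; move: e^-1 => w t0 s0 d0; field; rewrite s0 t0 d0. Qed.

Lemma F_mid_scalar t e (e' : F) : t != 0 -> e != 0 -> e != e' ->
  t^-1 * ((1 - t ^+ 2) / (1 - e^-1 * e')) * (e - e') = - (t - t^-1) * e.
Proof. by move=> t0 e0 ee; field; rewrite t0 e0 subr_eq0 ee. Qed.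

Lemma F_last_scalar t s e : e != 0 -> e ^+ 2 != 1 -> t != 0 -> s != 0 ->
  ((t^-1 - t) + (s^-1 - s) * e^-1) / (1 - e ^- 2) * (e^-1 - e)
  = (s - s^-1) + (t - t^-1) * e.
Proof. by move=> e0 e1 t0 s0; field; rewrite t0 s0 e0 subr_eq0 e1. Qed.

Lemma F_first_scalar q u s e : q != 0 -> u != 0 -> s != 0 -> e != 0 -> q ^+ 2 * e ^+ 2 != 1 ->
  ((u^-1 - u) + (s^-1 - s) / q * e^-1) * (q ^+ 2 * e ^+ 2) / (1 - q ^+ 2 * e ^+ 2)
    * ((q ^+ 2)^-1 * e^-1 - e)
  = (u^-1 - u) * e - (q ^+ 2)^-1 * ((s - s^-1) * q).
Proof.
by move=> q0 u0 s0 e0 e1; field; rewrite q0 u0 s0 e0 exprMn subr_eq0 eq_sym e1.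
Qed.

End Identities.

Section Koornwinder.

Variables (K : fieldType) (pr : params K) (m : nat).
Hypothesis p0 : params_neq0 pr.
Local Notation F := (ratfun K m).
Local Notation cst := (@cst K m).
Local Notation var := (@var K m).
Local Notation e := (ev_Y pr).

Hypothesis e_mid : forall (mu : weight m) i, mu (lo i) != mu (hi i) ->
  e mu (lo i) != e mu (hi i).
Hypothesis e_last : forall mu : weight m, mu ord_max != 0 -> e mu ord_max ^+ 2 != 1.
Hypothesis e_first : forall mu : weight m, qh pr ^+ 2 * e mu ord0 ^+ 2 != 1.

Lemma var_inj : injective var.
Proof.
move=> i j /eqP; rewrite tofrac_eq => /eqP e'.
have := mcoeffX K U_(i)%MM U_(i)%MM.
rewrite e' mcoeffX eqxx; case: eqP => [h _|_ /eqP]; last by rewrite eq_sym oner_eq0.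
by move/mnmP/(_ i): h; rewrite !mnm1E eqxx; case: eqP.
Qed.

Lemma varM_neq_cst i j c : var i * var j != cst c.
Proof.
rewrite -rmorphM tofrac_eq; apply/eqP => e'.
have := congr1 (fun p : {mpoly K[m.+1]} => msize p) e'.
rewrite -mpolyXD msizeX mdegD !mdeg1 => h.
by have := msizeC m.+1 c; rewrite -h; case: eqP.
Qed.

Lemma xi_first_inj (c : K) : c != 0 ->
  subst_inj (fun j => if j == ord0 then cst c / var ord0 else var j).
Proof.
move=> c0; apply: (@monomial_subst_inj _ _ (fun j => if j == ord0 then c else 1) 1%g
  (pred1 ord0)) => j /=; first by case: ifP => // _; exact: oner_neq0.
by rewrite perm1; case: eqP => [->//|_]; rewrite rmorph1 mul1r.
Qed.

Lemma xi_mid_inj (i : 'I_m) : subst_inj (fun j => var (tperm (lo i) (hi i) j)).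
Proof.
apply: (@monomial_subst_inj _ _ (fun => 1) (tperm (lo i) (hi i)) pred0) => j /=.
  exact: oner_neq0.
by rewrite rmorph1 mul1r.
Qed.

Lemma xi_last_inj :
  subst_inj (fun j : 'I_m.+1 => if j == ord_max then (var ord_max)^-1 else var j).
Proof.
apply: (@monomial_subst_inj _ _ (fun => 1) 1%g (pred1 ord_max)) => j /=.
  exact: oner_neq0.
by rewrite rmorph1 mul1r perm1; case: eqP => [->|].
Qed.

Lemma ratfun_coordinates : exists r_first r_last r_mid,
  [/\ coordinates cst (qh pr) var r_first r_last r_mid,
      r_first =1 @xi_first K pr m, r_last =1 @xi_last K m
    & forall i, r_mid i =1 @xi_mid K m i].
Proof.
have q0 : qh pr ^+ 2 != 0 by rewrite expf_neq0 // qh_neq0.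
exists (subst_rmorphism (xi_first_inj q0)), (subst_rmorphism xi_last_inj),
  (fun i => subst_rmorphism (@xi_mid_inj i)); split=> //; split.
- exact: var_inj.
- exact: varM_neq_cst.
- exact: rmorph_ratfun_ext.
- exact: (subst_cst (xi_first_inj q0)).
- by move=> i; exact: (subst_cst (@xi_mid_inj i)).
- exact: (subst_cst xi_last_inj).
- exact: (subst_var (xi_first_inj q0)).
- by move=> i; exact: (subst_var (@xi_mid_inj i)).
- exact: (subst_var xi_last_inj).
Qed.

Let e0 (mu : weight m) j : e mu j != 0.
Proof.
by apply: ev_Y_neq0; rewrite ?mulf_neq0 ?qh_neq0 ?th_neq0 ?t0h_neq0 ?tnh_neq0.
Qed.

Lemma mid_denom_neq0 (mu : weight m) i : mu (lo i) != mu (hi i) ->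
  1 - (e mu (lo i))^-1 * e mu (hi i) != 0.
Proof.
move=> ne; rewrite subr_eq0 eq_sym; apply: contra_neq (e_mid ne) => h.
by rewrite -[LHS]mulr1 -h mulrA mulfV // mul1r.
Qed.

Lemma ev_Fplus_mid (mu : weight m) i : mu (lo i) != mu (hi i) ->
  ev pr mu (Fplus_mid pr i)
  = (th pr)^-1 * ((1 - th pr ^+ 2) / (1 - (e mu (lo i))^-1 * e mu (hi i))).
Proof.
move=> ne; apply: value_atE; rewrite /Fplus_mid.
have d0 := mid_denom_neq0 ne.
apply: evalsM; first exact: evals_cst.
apply: evals_div => //; first exact: evals_cst.
apply: evalsB; first exact: evals1.
by apply: evalsM; [apply: evalsV|]; try exact: evals_var.
Qed.

Lemma ev_C_mid (mu : weight m) i : mu (lo i) != mu (hi i) ->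
  ev pr mu (C_mid pr i) = ev pr mu (Fplus_mid pr i) + th pr.
Proof.
move=> ne; rewrite ev_Fplus_mid //.
have d0 := mid_denom_neq0 ne.
rewrite -C_mid_scalar ?(th_neq0 p0) //; apply: value_atE; rewrite /C_mid.
have Vlo : evals (e mu) (var (lo i))^-1 (e mu (lo i))^-1.
  by apply: evalsV => //; exact: evals_var.
apply: evalsM; first exact: evals_cst.
apply: evals_div => //; apply: evalsB; try exact: evals1.
  by do 2?[apply: evalsM] => //; try exact: evals_cst; exact: evals_var.
by apply: evalsM => //; exact: evals_var.
Qed.

Lemma ev_Fplus_last (mu : weight m) : mu ord_max != 0 ->
  ev pr mu (Fplus_last pr m)
  = (((tnh pr)^-1 - tnh pr) + ((t0h pr)^-1 - t0h pr) * (e mu ord_max)^-1)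
    / (1 - e mu ord_max ^- 2).
Proof.
move=> ne; apply: value_atE; rewrite /Fplus_last.
have V : evals (e mu) (var ord_max)^-1 (e mu ord_max)^-1.
  by apply: evalsV => //; exact: evals_var.
apply: evals_div; first by rewrite subr_eq0 eq_sym invr_eq1 e_last.
  by apply: evalsD; [|apply: evalsM => //]; exact: evals_cst.
by rewrite -!exprVn; apply: evalsB; [exact: evals1 | exact: evalsX].
Qed.

Lemma ev_C_last (mu : weight m) : mu ord_max != 0 ->
  ev pr mu (C_last pr m) = ev pr mu (Fplus_last pr m) + tnh pr.
Proof.
move=> ne; rewrite ev_Fplus_last //.
have d0 : 1 - e mu ord_max ^- 2 != 0 by rewrite subr_eq0 eq_sym invr_eq1 e_last.
rewrite -C_last_scalar ?(tnh_neq0 p0) ?(t0h_neq0 p0) //.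
apply: value_atE; rewrite /C_last.
have V : evals (e mu) (var ord_max)^-1 (e mu ord_max)^-1.
  by apply: evalsV => //; exact: evals_var.
apply: evalsM; first exact: evals_cst.
apply: evals_div => //; last first.
  by rewrite -!exprVn; apply: evalsB; [exact: evals1 | exact: evalsX].
apply: evalsM; [apply: evalsB | apply: evalsD]; try exact: evals1.
  by apply: evalsM => //; exact: evals_cst.
by apply: evalsM => //; exact: evals_cst.
Qed.

Lemma ev_Fminus_first (mu : weight m) :
  ev pr mu (Fminus_first pr m)
  = (((unh pr)^-1 - unh pr) + ((u0h pr)^-1 - u0h pr) / qh pr * (e mu ord0)^-1)
    * (qh pr ^+ 2 * e mu ord0 ^+ 2) / (1 - qh pr ^+ 2 * e mu ord0 ^+ 2).
Proof.
apply: value_atE; rewrite /Fminus_first.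
have V : evals (e mu) (var ord0)^-1 (e mu ord0)^-1.
  by apply: evalsV => //; exact: evals_var.
have Q : evals (e mu) (cst (qh pr ^+ 2) * var ord0 ^+ 2) (qh pr ^+ 2 * e mu ord0 ^+ 2).
  by apply: evalsM; [exact: evals_cst | apply: evalsX; exact: evals_var].
apply: evals_div; first by rewrite subr_eq0 eq_sym e_first.
  apply: evalsM => //; apply: evalsD; first exact: evals_cst.
  by apply: evalsM => //; exact: evals_cst.
by apply: evalsB => //; exact: evals1.
Qed.

Lemma ev_var (mu : weight m) j : ev pr mu (var j) = e mu j.
Proof. by apply: value_atE; exact: evals_var. Qed.

Section Assembly.

Variables (r_first r_last : {rmorphism F -> F}) (r_mid : 'I_m -> {rmorphism F -> F}).
Hypothesis crd : coordinates cst (qh pr) var r_first r_last r_mid.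
Hypothesis r_firstE : r_first =1 @xi_first K pr m.
Hypothesis r_lastE : r_last =1 @xi_last K m.
Hypothesis r_midE : forall i, r_mid i =1 @xi_mid K m i.

Local Notation Tm := (Tmid cst pr var r_mid).
Local Notation Tk := (Tnat cst pr var r_mid).
Local Notation Tn := (Tlast cst pr var r_last).
Local Notation S := (Tfirst cst pr var r_first).

Lemma T_midE i f : T_mid pr i f = Tm i f.
Proof.
have c0 : cst (th pr) != 0 by rewrite fmorph_eq0 th_neq0.
rewrite /Tmid /bmid -dlop_partial // r_midE.
by rewrite /T_mid !(rmorphXn, fmorphV).
Qed.

Lemma T_lastE f : T_last pr f = Tn f.
Proof.
have c0 : cst (tnh pr) != 0 by rewrite fmorph_eq0 tnh_neq0.
rewrite /Tlast /blast -dlop_partial // r_lastE.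
by rewrite /T_last !(rmorphXn, rmorphM, fmorphV).
Qed.

Lemma foldr_T_mids g s :
  foldr (fun (T : F -> F) f => T f) g [seq @T_mid K pr m i | i <- s]
  = foldr Tk g [seq val i | i <- s].
Proof.
rewrite !foldr_map; elim: s => //= i s ->.
by rewrite T_midE /Tnat valK.
Qed.

Lemma pal_rec_foldr r f : (r <= m)%N -> pal_rec m Tk Tn r f
  = foldr Tk (Tn (foldr Tk f (rev (iota (m - r) r)))) (iota (m - r) r).
Proof.
elim: r f => [//|r IH] f rm; rewrite [LHS]/= IH ?(ltnW rm) //.
rewrite -[iota (m - r.+1) r.+1]/((m - r.+1)%N :: iota (m - r.+1).+1 r) subnSK //.
by rewrite rev_cons foldr_rcons.
Qed.

Lemma T0vee_invE f : T0vee_inv pr f = Bop m Tk (Xnat var) Tn f.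
Proof.
rewrite /T0vee_inv /T_mids foldr_cat /= -map_rev !foldr_T_mids T_lastE map_rev.
rewrite val_enum_ord /Bop /Xnat /pal subn0 pal_rec_foldr // subnn.
by have -> : inord 0 = ord0 :> 'I_m.+1 by apply/val_inj; rewrite /= inordK.
Qed.

Lemma is_Ehat_rec E : is_Ehat pr E -> Ehat_rec cst pr var r_last r_mid
  (fun mu => ev pr mu (Fminus_first pr m)) (fun mu => ev pr mu (Fplus_last pr m))
  (fun i mu => ev pr mu (Fplus_mid pr i)) E.
Proof.
case=> E0 Ef Em El; split=> // [mu mu0|i mu mui|mu mun].
- by rewrite Ef // /tau_first T0vee_invE.
- by rewrite Em // /tau_mid T_midE /Tnat valK.
by rewrite El // /tau_last T_lastE.
Qed.

Lemma T0vee_inv_eig E (mu : weight m) : is_Ehat pr E ->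
  T0vee_inv pr (E mu) = cst (e mu ord0) *
    (var ord0 * heckeV cst (t0h pr - (t0h pr)^-1) S (E mu)).
Proof.
move=> hE; rewrite T0vee_invE; apply: (Bop_eigenvector crd p0 (is_Ehat_rec hE)).
- move=> nu nu0; rewrite ev_Fminus_first F_first_scalar //;
    by [apply: qh_neq0 | apply: unh_neq0 | apply: u0h_neq0].
- move=> i nu nui; have ne : nu (lo i) != nu (hi i) by rewrite gt_eqF.
  by rewrite ev_Fplus_mid // F_mid_scalar ?(th_neq0 p0) // e_mid.
move=> nu nun; have ne : nu ord_max != 0 by rewrite gt_eqF.
by rewrite ev_Fplus_last // F_last_scalar ?(tnh_neq0 p0) ?(t0h_neq0 p0) // e_last.
Qed.

Lemma heckeV_firstE f : heckeV cst (t0h pr - (t0h pr)^-1) S f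
  = dlop (cst (t0h pr)) (bfirst (cst (qh pr)) (cst (t0h pr)) (cst (u0h pr)) (var ord0))
      (fun=> xi_first pr f) f
    - (cst (t0h pr) - (cst (t0h pr))^-1) * f.
Proof. by rewrite /heckeV /Tfirst /dlop r_firstE rmorphB fmorphV. Qed.

End Assembly.

(** The assumptions on e keep the denominators of C, F^+ and F^- from vanishing. *)
Theorem Ehat_recursion (E : weight m -> F) (mu : weight m) : is_Ehat pr E ->
  [/\ forall i : 'I_m, mu (lo i) > mu (hi i) ->
        E (s_mid i mu) =
          cst (ev pr mu (C_mid pr i)) * E mu
          - (cst (th pr)^-1 * var (hi i) - cst (th pr) * var (lo i))
            * partial_mid i (E mu),
      mu ord_max > 0 ->
        E (s_last mu) =
          cst (ev pr mu (C_last pr m)) * E mu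
          - cst (tnh pr)^-1 * (1 - cst (tnh pr * unh pr) * var ord_max)
            * (1 + cst (tnh pr / unh pr) * var ord_max) * partial_last (E mu)
    & mu ord0 <= 0 ->
        E (s_first mu) =
          cst (ev pr mu (Fminus_first pr m)) * E mu
          + cst (t0h pr)^-1 * cst (ev pr mu (var ord0)) * var ord0 * E mu
          - cst (ev pr mu (var ord0))
            * (cst (t0h pr)^-1 * var ord0 ^+ 3
               + cst (((u0h pr)^-1 - u0h pr) * qh pr) * var ord0 ^+ 2
               - cst (t0h pr * qh pr ^+ 2) * var ord0)
            * partial_first pr (E mu)].
Proof.
move=> hE; have tc : cst (th pr) != 0 by rewrite fmorph_eq0 th_neq0.
have tnc : cst (tnh pr) != 0 by rewrite fmorph_eq0 tnh_neq0.
have t0c : cst (t0h pr) != 0 by rewrite fmorph_eq0 t0h_neq0.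
have u0c : cst (u0h pr) != 0 by rewrite fmorph_eq0 u0h_neq0.
split=> [i mui|mun|mu0].
- have ne : mu (lo i) != mu (hi i) by rewrite gt_eqF.
  rewrite (Ehat_mid hE) //; apply: mid_expand tc _ _ _.
  + exact: fmorphV.
  + exact: rmorphXn.
  by rewrite ev_C_mid //; exact: rmorphD.
- have ne : mu ord_max != 0 by rewrite gt_eqF.
  rewrite (Ehat_last hE) //; apply: last_expand tnc _ _ _.
  + exact: fmorphV.
  + exact: rmorphXn.
  by rewrite ev_C_last //; exact: rmorphD.
have [r0 [rl [rm [crd r0E rlE rmE]]]] := ratfun_coordinates.
rewrite (Ehat_first hE) // /tau_first (T0vee_inv_eig crd rlE rmE) // heckeV_firstE //.
rewrite ev_var; apply: first_expand t0c u0c _ _ _ _.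
- exact: fmorphV.
- by rewrite rmorphM rmorphB fmorphV.
- by rewrite rmorphM rmorphXn.
- exact: rmorphXn.
Qed.

End Koornwinder.

Theorem proposition4p2 (R : realType) (m : nat)
    (Ehat : weight m -> ratfun (genK R) m) (mu : weight m) :
  let pr := gen_params R in
  let c := @cst (genK R) m in
  let x := @var (genK R) m in
  let x1 := x ord0 in
  let xn := x ord_max in
  let Y1 := @var (genK R) m ord0 in
  is_Ehat pr Ehat ->
  [/\ forall i : 'I_m,
        (mu (lo i) > mu (hi i) /\ mu (hi i) > 0)
        \/ (0 > mu (lo i) /\ mu (lo i) > mu (hi i)) ->
        Ehat (s_mid i mu) =
          c (ev pr mu (C_mid pr i)) * Ehat mu
          - (c (th pr)^-1 * x (hi i) - c (th pr) * x (lo i))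
            * partial_mid i (Ehat mu),
      mu ord_max > 0 ->
        Ehat (s_last mu) =
          c (ev pr mu (C_last pr m)) * Ehat mu
          - c (tnh pr)^-1 * (1 - c (tnh pr * unh pr) * xn)
            * (1 + c (tnh pr / unh pr) * xn) * partial_last (Ehat mu)
    & mu ord0 <= 0 ->
        Ehat (s_first mu) =
          c (ev pr mu (Fminus_first pr m)) * Ehat mu
          + c (t0h pr)^-1 * c (ev pr mu Y1) * x1 * Ehat mu
          - c (ev pr mu Y1)
            * (c (t0h pr)^-1 * x1 ^+ 3
               + c (((u0h pr)^-1 - u0h pr) * qh pr) * x1 ^+ 2
               - c (t0h pr * qh pr ^+ 2) * x1)
            * partial_first pr (Ehat mu)].
Proof.
move=> pr c x x1 xn Y1 hE.
have [Ha Hb Hc] := Ehat_recursion (gen_params_neq0 R) (@ev_Y_mid_neq R m)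
  (@ev_Y_last_neq R m) (@ev_Y_first_neq R m) mu hE.
split=> // i h; apply: Ha; by case: h => -[].
Qed.
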